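(* Let $M$ be an almost Hermitian manifold, of dimension $2m$, with pointwise constant type $\alpha$. If $M$ satisfies the axiom of coholomorphic $(2n+1)$-spheres for some $n$ (an integer with $1\le n<m$) and if $\dim M\ge 6$, then $M$ is a space of constant curvature $\alpha$ and $M$ has global constant type.
   Context: An almost Hermitian manifold is a smooth manifold $M$ with a Riemannian metric $g$ and an almost complex structure $J$ satisfying $g(JX,JY)=g(X,Y)$. Let $\widetilde\nabla$ be its Levi-Civita connection and $R(X,Y,Z,U)=g(R(X,Y)Z,U)$ its curvature tensor, with the convention that the sectional curvature of the plane spanned by orthonormal $X,Y$ is $R(X,Y,Y,X)$. A $k$-plane is a $k$-dimensional linear subspace of a tangent space $T_pM$. A $2n$-plane $\pi$ is holomorphic if $J\pi=\pi$; a plane $\pi$ is antiholomorphic if $J\pi\perp\pi$. A $(2n+1)$-plane is coholomorphic if it contains a holomorphic $2n$-plane. Constant type: put $\lambda(X,Y)=R(X,Y,Y,X)-R(X,Y,JY,JX)$. $M$ is of pointwise constant type $\alpha$ (where $\alpha$ is a function on $M$) if for each $p\in M$ and each $X\in T_pM$ one has $\alpha(p)g(X,X)=\lambda(X,Y)=\lambda(X,Z)$ whenever the $2$-planes defined by $X,Y$ and by $X,Z$ are antiholomorphic (with $X\perp Y$ and $X\perp Z$) and $g(Y,Y)=g(Z,Z)=1$. $M$ has global constant type if, for vector fields $X,Y$ on $M$ with $g(JX,Y)=g(X,Y)=0$, $\lambda(X,Y)$ is a constant whenever $g(X,X)=g(Y,Y)=1$. For a submanifold $N$ of $M$ with Levi-Civita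 connection $\nabla$, the second fundamental form is $h(X,Y)=\widetilde\nabla_XY-\nabla_XY$ for $X,Y$ tangent to $N$. $N$ is totally umbilical if $h(X,Y)=g(X,Y)H$ for all $X,Y$ tangent to $N$, where $H=(1/\dim N)\,\mathrm{trace}\,h$ is the mean curvature vector. Axiom of coholomorphic $(2n+1)$-spheres ($n$ a fixed integer, $1\le n<m$): for each point $p\in M$ and each coholomorphic $(2n+1)$-plane $\pi$ in $T_pM$, there exists a $(2n+1)$-dimensional totally umbilical submanifold $N$ of $M$ containing $p$ such that $T_pN=\pi$.
   Formalization: The manifold M is additionally assumed connected; otherwise a disjoint union of round 6-spheres of different radii satisfies all hypotheses but is not of one constant curvature and has no global constant type. *)

(* Defs.v *)
From HB Require Import structures.
From mathcomp Require Import all_boot all_order all_algebra.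
From mathcomp Require Import all_classical all_reals all_analysis.

Set Implicit Arguments.
Unset Strict Implicit.
Unset Printing Implicit Defensive.

Import Order.TTheory GRing.Theory Num.Theory.
Import numFieldNormedType.Exports.
Local Open Scope classical_set_scope.
Local Open Scope ring_scope.

(* Tangent vectors are handled in coordinates, as row vectors; linear maps act
   on the right: 'd f x v = v *m 'J f x and the almost complex structure is
   X |-> X *m J. *)

(* C^r on an open set U. *)
Fixpoint cdiff (R : realType) (d : nat) (V : normedModType R) (r : nat)
    (U : set 'rV[R]_d) (f : 'rV[R]_d -> V) : Prop :=
  match r with
  | 0 => forall x, U x -> {for x, continuous f}
  | r'.+1 => (forall x, U x -> differentiable f x) /\
             forall v, cdiff r' U (fun x => 'D_v f x)
  end.

Definition smooth (R : realType) (d : nat) (V : normedModType R)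
    (U : set 'rV[R]_d) (f : 'rV[R]_d -> V) : Prop :=
  forall r, cdiff r U f.

(* The values of [coord] outside [dom], and of [para] outside [coord @` dom],
   are irrelevant. *)
Record chart (R : realType) (T : topologicalType) (d : nat) := Chart {
  dom : set T;
  coord : T -> 'rV[R]_d;
  para : 'rV[R]_d -> T;
  dom_open : open dom;
  img_open : open (coord @` dom);
  coordK : forall p, dom p -> para (coord p) = p;
  coord_continuous : forall p, dom p -> {for p, continuous coord};
  para_continuous : forall p, dom p -> {for coord p, continuous para}
}.

Section maps.
Variables (R : realType) (S T : topologicalType) (k d : nat).
Implicit Types (b : chart R S k) (c : chart R T d) (f : S -> T).

Definition local_dom f b c : set 'rV[R]_k :=
  coord b @` (dom b `&` f @^-1` dom c).

Definition local_rep f b c : 'rV[R]_k -> 'rV[R]_d :=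
  coord c \o f \o para b.

End maps.

Record manifold (R : realType) (d : nat) := Manifold {
  carrier :> topologicalType;
  atlas : set (chart R carrier d);
  manifold_hausdorff : hausdorff_space carrier;
  manifold_second_countable : @second_countable carrier;
  atlas_cover : forall p, exists2 b, atlas b & dom b p;
  atlas_smooth : forall b c, atlas b -> atlas c ->
    smooth (local_dom id b c) (local_rep id b c)
}.

Definition chart_at (R : realType) (d : nat) (M : manifold R d) (p : M)
    (b : chart R M d) : Prop := atlas b /\ dom b p.

Definition smooth_map (R : realType) (k d : nat) (N : manifold R k)
    (M : manifold R d) (f : N -> M) : Prop :=
  continuous f /\
  forall (b : chart R N k) (c : chart R M d), atlas b -> atlas c ->
    smooth (local_dom f b c) (local_rep f b c).

(* A vector field, given by its expression in each chart. *)
Definition vector_field (R : realType) (d : nat) (M : manifold R d)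
    (X : chart R M d -> 'rV[R]_d -> 'rV[R]_d) : Prop :=
  (forall b, atlas b -> smooth (coord b @` dom b) (X b)) /\
  forall b c, atlas b -> atlas c -> forall x, local_dom id b c x ->
    X c (local_rep id b c x) = X b x *m 'J (local_rep id b c) x.

Definition ip (R : realType) (d : nat) (G : 'M[R]_d) (u v : 'rV[R]_d) : R :=
  (u *m G *m v^T) 0 0.

(* g x is the Gram matrix of the metric at x, in a chart. *)
Section local_riemannian.
Variables (R : realType) (d : nat) (g : 'rV[R]_d -> 'M[R]_d).
Implicit Types (x u v w z : 'rV[R]_d) (X Y Z : 'rV[R]_d -> 'rV[R]_d).

(* g(nabla_u v, w), for constant u, v, w and nabla the Levi-Civita connection of
   g: this is the Koszul formula. *)
Definition koszul x u v w : R :=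
  2^-1 * ('D_u (fun y => ip (g y) v w) x + 'D_v (fun y => ip (g y) u w) x
          - 'D_w (fun y => ip (g y) u v) x).

(* u^i v^j Gamma_ij^k. *)
Definition christoffel x u v : 'rV[R]_d :=
  (\row_k koszul x u v (delta_mx 0 k)) *m invmx (g x).

Definition nabla X Y x : 'rV[R]_d :=
  'D_(X x) Y x + christoffel x (X x) (Y x).

Definition lie_bracket X Y x : 'rV[R]_d := 'D_(X x) Y x - 'D_(Y x) X x.

Definition curvature_op X Y Z x : 'rV[R]_d :=
  nabla X (nabla Y Z) x - nabla Y (nabla X Z) x - nabla (lie_bracket X Y) Z x.

(* Being tensorial, the curvature may be computed on constant extensions. *)
Definition curv x u v w z : R :=
  ip (g x) (curvature_op (cst u) (cst v) (cst w) x) z.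

End local_riemannian.

Record almost_hermitian (R : realType) (d : nat) (M : manifold R d) :=
  AlmostHermitian {
  metric : chart R M d -> 'rV[R]_d -> 'M[R]_d;
  acs : chart R M d -> 'rV[R]_d -> 'M[R]_d;
  metric_smooth : forall b, atlas b -> smooth (coord b @` dom b) (metric b);
  metric_sym : forall b p, chart_at p b ->
    (metric b (coord b p))^T = metric b (coord b p);
  metric_pos : forall b p, chart_at p b -> forall u, u != 0 ->
    0 < ip (metric b (coord b p)) u u;
  metric_change : forall b c, atlas b -> atlas c ->
    forall x, local_dom id b c x ->
    metric b x = 'J (local_rep id b c) x *m metric c (local_rep id b c x)
                 *m ('J (local_rep id b c) x)^T;
  acs_smooth : forall b, atlas b -> smooth (coord b @` dom b) (acs b);
  acs_sqr : forall b p, chart_at p b ->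
    acs b (coord b p) *m acs b (coord b p) = - 1%:M;
  acs_change : forall b c, atlas b -> atlas c ->
    forall x, local_dom id b c x ->
    acs b x *m 'J (local_rep id b c) x =
    'J (local_rep id b c) x *m acs c (local_rep id b c x);
  hermitian : forall b p, chart_at p b -> forall u v,
    ip (metric b (coord b p)) (u *m acs b (coord b p)) (v *m acs b (coord b p))
    = ip (metric b (coord b p)) u v
}.

(* A k-plane is the row space of a k x d matrix of rank k; below, G and J are
   the metric and the almost complex structure at a point. *)
Section planes.
Variables (R : realType) (d : nat) (G J : 'M[R]_d).

Definition plane (k : nat) (A : 'M[R]_(k, d)) : Prop := row_free A.

Definition holomorphic_plane (k : nat) (A : 'M[R]_(k, d)) : Prop :=
  plane A /\ (A *m J == A)%MS.

Definition antiholomorphic_plane (k : nat) (A : 'M[R]_(k, d)) : Prop :=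
  plane A /\
  forall u v : 'rV[R]_d, (u <= A)%MS -> (v <= A)%MS -> ip G (u *m J) v = 0.

Definition coholomorphic_plane (n : nat) (A : 'M[R]_((2 * n).+1, d)) : Prop :=
  plane A /\
  exists B : 'M[R]_(2 * n, d), holomorphic_plane B /\ (B <= A)%MS.

End planes.

(* A submanifold is an injectively immersed manifold. *)
Definition submanifold (R : realType) (k d : nat) (N : manifold R k)
    (M : manifold R d) (f : N -> M) : Prop :=
  [/\ smooth_map f, injective f &
      forall (b : chart R N k) (c : chart R M d), atlas b -> atlas c ->
      forall y, local_dom f b c y -> row_free ('J (local_rep f b c) y)].

Section second_fundamental_form.
Variables (R : realType) (k d : nat) (N : manifold R k) (M : manifold R d).
Variables (H : almost_hermitian M) (f : N -> M).
Variables (b : chart R N k) (c : chart R M d).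
Let F := local_rep f b c.

Definition induced_metric (y : 'rV[R]_k) : 'M[R]_k :=
  'J F y *m metric H c (F y) *m ('J F y)^T.

(* The difference between the ambient covariant derivative of the vector field
   dF(v) along F in the direction u and dF of the intrinsic one, v being
   extended as a constant field. *)
Definition second_form (y u v : 'rV[R]_k) : 'rV[R]_d :=
  'D_u (fun z => v *m 'J F z) y
  + christoffel (metric H c) (F y) (u *m 'J F y) (v *m 'J F y)
  - nabla induced_metric (cst u) (cst v) y *m 'J F y.

Definition mean_curvature (y : 'rV[R]_k) : 'rV[R]_d :=
  k%:R^-1 *: \sum_(i < k) \sum_(j < k)
    invmx (induced_metric y) i j *:
    second_form y (delta_mx 0 i) (delta_mx 0 j).

End second_fundamental_form.

Definition totally_umbilical (R : realType) (k d : nat) (N : manifold R k)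
    (M : manifold R d) (H : almost_hermitian M) (f : N -> M) : Prop :=
  forall (b : chart R N k) (c : chart R M d), atlas b -> atlas c ->
  forall y, local_dom f b c y -> forall u v,
    second_form H f b c y u v =
    ip (induced_metric H f b c y) u v *: mean_curvature H f b c y.

Section axioms.
Variables (R : realType) (d : nat) (M : manifold R d) (H : almost_hermitian M).

(* T_qN = pi, for pi given in the chart c of M around f q. *)
Definition tangent_space_is (k : nat) (N : manifold R k) (f : N -> M) (q : N)
    (c : chart R M d) (A : 'M[R]_(k, d)) : Prop :=
  forall b : chart R N k, chart_at q b ->
    ('J (local_rep f b c) (coord b q) == A)%MS.

Definition axiom_coholomorphic_spheres (n : nat) : Prop :=
  forall (p : M) (c : chart R M d), chart_at p c ->
  forall A : 'M[R]_((2 * n).+1, d),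
  coholomorphic_plane (acs H c (coord c p)) A ->
  exists (N : manifold R (2 * n).+1) (f : N -> M),
    [/\ submanifold f, totally_umbilical H f &
        exists2 q, f q = p & tangent_space_is f q c A].

Definition lambda (c : chart R M d) (x X Y : 'rV[R]_d) : R :=
  curv (metric H c) x X Y Y X
  - curv (metric H c) x X Y (Y *m acs H c x) (X *m acs H c x).

Definition pointwise_constant_type (alpha : M -> R) : Prop :=
  forall (p : M) (c : chart R M d), chart_at p c ->
  let x := coord c p in
  let G := metric H c x in
  let J := acs H c x in
  forall X Y Z : 'rV[R]_d,
    antiholomorphic_plane G J (col_mx X Y) ->
    antiholomorphic_plane G J (col_mx X Z) ->
    ip G X Y = 0 -> ip G X Z = 0 -> ip G Y Y = 1 -> ip G Z Z = 1 ->
    alpha p * ip G X X = lambda c x X Y /\ lambda c x X Y = lambda c x X Z.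

(* The orthogonality conditions hold everywhere, whereas the normalization is
   only asked at the point where lambda is evaluated: globally defined unit
   vector fields need not exist. *)
Definition global_constant_type : Prop :=
  exists a : R, forall X Y : chart R M d -> 'rV[R]_d -> 'rV[R]_d,
  vector_field X -> vector_field Y ->
  (forall p c, chart_at p c ->
    let x := coord c p in
    ip (metric H c x) (X c x *m acs H c x) (Y c x) = 0 /\
    ip (metric H c x) (X c x) (Y c x) = 0) ->
  forall p c, chart_at p c ->
    let x := coord c p in
    ip (metric H c x) (X c x) (X c x) = 1 ->
    ip (metric H c x) (Y c x) (Y c x) = 1 ->
    lambda c x (X c x) (Y c x) = a.

Definition constant_curvature (a : R) : Prop :=
  forall (p : M) (c : chart R M d), chart_at p c ->
  let x := coord c p in
  forall X Y : 'rV[R]_d,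
    ip (metric H c x) X X = 1 -> ip (metric H c x) Y Y = 1 ->
    ip (metric H c x) X Y = 0 ->
    curv (metric H c) x X Y Y X = a.

End axioms.

(* Main.v *)
Require Import Defs.
From mathcomp Require Import all_boot all_order all_algebra.
From mathcomp Require Import all_classical all_reals all_analysis.
From mathcomp Require Import zify ring lra.

(** The theorem is a statement about the curvature tensor R at each point,
    followed by Schur's lemma.

    A totally umbilical submanifold satisfies the Codazzi equation in the form: for P, Q, S tangent to it and U normal to it,
    R(P, Q, S, U) is a combination of g(P, S) and g(Q, S); in particular it
    vanishes when S is orthogonal to P and Q (umbilical_curv). This is obtained
    from the Gauss formula, written as an identity between matrix-valued functions
    of the coordinates of the submanifold, by differentiating it once more and
    antisymmetrizing (codazzi_algebra and codazzi).

    Whenever Y is orthogonal to X, J X, U and J U, and X is orthogonal to U, there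
    is a coholomorphic (2n+1)-plane containing Y, J Y and X and orthogonal to U
    (exists_coholomorphic). The axiom of spheres thus kills R(Y, J Y, X, U) and
    R(X, Y, J Y, U) (sphere_codazzi). With U = J X this says that
    R(X, Y, J Y, J X) = 0, so that the constant type hypothesis becomes: the
    sectional curvature of every antiholomorphic plane is alpha.

    Subtract from R the tensor alpha R_0 of constant curvature alpha. What is left,
    T, vanishes on antiholomorphic planes. Testing it on the antiholomorphic
    planes spanned by X + Y and J X - J Y shows that the holomorphic sectional
    curvatures satisfy H(X) + H(Y) = 0 for X and Y of equal norm spanning an
    antiholomorphic plane (holo_sum); as the complex dimension is at least 3,
    three such vectors exist and H = 0. Polarizing the same test handles the mixed
    terms T(J X, X, X, Z) (mixed_eq0), and T = 0 (codazzi_eq0).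

    Hence R = alpha R_0 at every point. In a chart alpha is a quotient of smooth
    functions, so the second Bianchi identity can be applied to alpha R_0 and gives
    d alpha = 0 (schur, schur_curvature). Therefore alpha is locally constant,
    and constant because the manifold is connected. The global constant type
    follows from the pointwise one.

    All computations take place in coordinates. The connection is encoded by the
    matrices A u such that the covariant derivative of a field w in the direction u
    is the derivative of w plus w *m A u; the identities between A, its first and
    its second derivatives are then proved for arbitrary matrices, separately from
    the analysis. *)

Set Implicit Arguments.
Unset Strict Implicit.
Unset Printing Implicit Defensive.

Import Order.TTheory GRing.Theory Num.Theory.
Import numFieldNormedType.Exports.
Local Open Scope classical_set_scope.
Local Open Scope ring_scope.

Local Opaque derive.

(** * Smooth functions *)

Section entries.
Variables (R : realType) (V : normedModType R) (p q : nat).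
Implicit Types (f : V -> 'M[R]_(p, q)) (x v : V).

Lemma differentiable_mx_coord f x i j :
  differentiable f x -> differentiable (fun y => f y i j) x.
Proof.
move=> df; apply: (@differentiable_comp _ _ _ _ f (fun N => N i j)) => //.
exact: differentiable_coord.
Qed.

Lemma differentiable_mx f x :
  (forall i j, differentiable (fun y => f y i j) x) -> differentiable f x.
Proof.
move=> df.
have -> : f = \sum_i \sum_j (fun y => f y i j *: (delta_mx i j : 'M[R]_(p, q))).
  apply/funext => y; rewrite fct_sumE [LHS]matrix_sum_delta.
  by apply: eq_bigr => i _; rewrite fct_sumE.
apply: differentiable_sum => i; apply: differentiable_sum => j.
exact: differentiableZl.
Qed.

Lemma derive_mx_coord f x v i j :
  differentiable f x -> ('D_v f x) i j = 'D_v (fun y => f y i j) x.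
Proof. by move=> df; rewrite derive_mx ?mxE//; exact: diff_derivable. Qed.

Lemma continuous_mx f x :
  (forall i j, {for x, continuous (fun y => f y i j)}) -> {for x, continuous f}.
Proof.
move=> cf; apply/cvgrPdist_le => /= e e0; near=> y.
rewrite /Num.Def.normr/= mx_normrE (bigmax_le _ (ltW e0))//= => i _.
rewrite !mxE/=.
move: i; near: y; apply: filter_forall => /= i.
exact: (cvgrPdist_le _ _).1 (cf i.1 i.2) _ e0.
Unshelve. all: by end_near. Qed.

End entries.

Section locality.
Variables (R : realType) (V W : normedModType R).

(** The difference of f and g vanishes near x, and its differential is 0. *)
Lemma near_eq_differentiable (f g : V -> W) x :
  (\near x, f x = g x) -> differentiable f x -> differentiable g x.
Proof.
move=> fg df.
rewrite (_ : g = f + (g - f)); last by rewrite addrC subrK.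
apply: differentiableD => //; set h := g - f.
have h0 : \near x, h x = 0.
  by apply: filterS fg => y /= e; rewrite /h -[LHS]/(g y - f y) e subrr.
have hx0 := nbhs_singleton h0.
apply/diffP => /=.
apply: (@getPex _ (fun (df : {linear V -> W}) => continuous df /\
  forall y, h y = h (lim (nbhs x)) + df (y - lim (nbhs x))
                  +o_(y \near x) (y - lim (nbhs x)))).
exists (\0 : {linear V -> W}); split; first exact: cst_continuous.
suff {1}-> : h = cst 0 +o_x (fun y : V => y - lim (nbhs x)).
  by move=> y; rewrite lim_id// hx0 /= addr0.
apply/eqaddoP => e e0; near=> y.
rewrite /= -[X in `|X|]/(h y - 0) subr0 (near h0 y)// normr0.
by rewrite mulr_ge0// ltW.
Unshelve. all: by end_near. Qed.
End locality.

Section directional.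
Variables (R : realType).

Lemma derive_comp (U V W : normedModType R) (f : U -> V) (g : V -> W) x v :
  differentiable f x -> differentiable g (f x) ->
  'D_v (g \o f) x = 'D_('D_v f x) g (f x).
Proof.
move=> df dg; rewrite !deriveE//; last exact: differentiable_comp.
by rewrite diff_comp.
Qed.

Variables (V W : normedModType R).
Implicit Types (f : V -> W) (x u v : V).

Lemma derive_dirP f x a u v : differentiable f x ->
  'D_(a *: u + v) f x = a *: 'D_u f x + 'D_v f x.
Proof. by move=> df; rewrite !deriveE// linearP. Qed.

Lemma derive_dirZ f x a u : differentiable f x ->
  'D_(a *: u) f x = a *: 'D_u f x.
Proof. by move=> df; rewrite !deriveE// linearZ. Qed.

Lemma derive_dir_sum d (f : 'rV[R]_d -> W) (x w : 'rV[R]_d) :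
  differentiable f x ->
  'D_w f x = \sum_k w 0 k *: 'D_(delta_mx 0 k) f x.
Proof.
move=> df; rewrite deriveE// {1}(row_sum_delta w) linear_sum.
by apply: eq_bigr => k _; rewrite linearZ /= deriveE.
Qed.

End directional.

Section cdiff_class.
Variables (R : realType) (d : nat) (U : set 'rV[R]_d).
Hypothesis oU : open U.
Implicit Types (x u v : 'rV[R]_d) (V : normedModType R).

Lemma cdiffS V r (f : 'rV[R]_d -> V) : cdiff r.+1 U f -> cdiff r U f.
Proof.
elim: r f => [|r IH] f [df Df]; first by move=> x /df/differentiable_continuous.
by split=> // v; exact: IH.
Qed.

Lemma near_open x (P : set 'rV[R]_d) :
  U x -> (forall y, U y -> P y) -> \forall y \near x, P y.
Proof. by move=> Ux UP; apply: filterS UP _; exact: open_nbhs_nbhs. Qed.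

Lemma derive_ext V (f g : 'rV[R]_d -> V) x v :
  (forall y, U y -> f y = g y) -> U x -> 'D_v f x = 'D_v g x.
Proof. by move=> fg Ux; apply: near_eq_derive; exact: near_open fg. Qed.

Lemma cdiff_ext V r (f g : 'rV[R]_d -> V) :
  (forall y, U y -> f y = g y) -> cdiff r U f -> cdiff r U g.
Proof.
elim: r f g => [|r IH] f g fg.
  move=> cf x Ux; rewrite /prop_for /continuous_at -fg//.
  exact: cvg_trans (near_eq_cvg (near_open Ux fg)) (cf x Ux).
move=> [df Df]; split.
  move=> x Ux; apply: near_eq_differentiable (df x Ux).
  exact: near_open fg.
by move=> v; refine (IH _ _ _ (Df v)) => y Uy; exact: derive_ext.
Qed.

Lemma cdiff_cst V r (a : V) : cdiff r U (fun=> a).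
Proof.
elim: r a => [|r IH] a; first by move=> x _; exact: cst_continuous.
split=> [x _|v]; first exact: differentiable_cst.
rewrite (_ : 'D_v (fun=> a) = fun=> 0); first exact: IH.
by apply/funext => x; exact: derive_cst.
Qed.

Lemma cdiffD V r (f g : 'rV[R]_d -> V) :
  cdiff r U f -> cdiff r U g -> cdiff r U (fun x => f x + g x).
Proof.
elim: r f g => [|r IH] f g; first by move=> cf cg x Ux; apply: continuousD; auto.
move=> [df Df] [dg Dg]; split.
  by move=> x Ux; apply: differentiableD; auto.
move=> v; apply: cdiff_ext (IH _ _ (Df v) (Dg v)) => x Ux.
by rewrite -deriveD//; apply: diff_derivable; auto.
Qed.

Lemma cdiffM r (f g : 'rV[R]_d -> R) :
  cdiff r U f -> cdiff r U g -> cdiff r U (fun x => f x * g x).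
Proof.
elim: r f g => [|r IH] f g; first by move=> cf cg x Ux; apply: continuousM; auto.
move=> fr gr; have [df Df] := fr; have [dg Dg] := gr; split.
  by move=> x Ux; apply: differentiableM; auto.
move=> v; have H := cdiffD (IH _ _ (cdiffS fr) (Dg v)) (IH _ _ (cdiffS gr) (Df v)).
apply: cdiff_ext H => x Ux.
by rewrite [RHS](@deriveM _ _ f g)//; apply: diff_derivable; auto.
Qed.

Lemma cdiffV r (f : 'rV[R]_d -> R) : (forall x, U x -> f x != 0) ->
  cdiff r U f -> cdiff r U (fun x => (f x)^-1).
Proof.
move=> f0; elim: r => [|r IH] fr.
  by move=> x Ux; apply: continuousV; [exact: f0|exact: fr].
have [df Df] := fr; have fVr := IH (cdiffS fr); split.
  by move=> x Ux; apply: differentiableV; auto.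
move=> v.
have H := cdiffM (cdiff_cst r (-1 : R)) (cdiffM (cdiffM fVr fVr) (Df v)).
apply: cdiff_ext H => x Ux.
rewrite [RHS](@deriveV _ _ f); [|exact: f0|by apply: diff_derivable; auto].
by rewrite mulN1r scaleNr /GRing.scale/= expr2 invfM.
Qed.

Lemma cdiff_sum r I (s : seq I) (P : pred I) (f : I -> 'rV[R]_d -> R) :
  (forall i, P i -> cdiff r U (f i)) ->
  cdiff r U (fun x => \sum_(i <- s | P i) f i x).
Proof.
move=> fr; elim: s => [|i s IH].
  by under eq_fun do rewrite big_nil; exact: cdiff_cst.
under eq_fun do rewrite big_cons.
by case Pi: (P i) => //; apply: cdiffD IH; exact: fr.
Qed.

Lemma cdiff_prod r I (s : seq I) (P : pred I) (f : I -> 'rV[R]_d -> R) :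
  (forall i, P i -> cdiff r U (f i)) ->
  cdiff r U (fun x => \prod_(i <- s | P i) f i x).
Proof.
move=> fr; elim: s => [|i s IH].
  by under eq_fun do rewrite big_nil; exact: cdiff_cst.
under eq_fun do rewrite big_cons.
by case Pi: (P i) => //; apply: cdiffM IH; exact: fr.
Qed.

Lemma cdiff_mxP p q r (f : 'rV[R]_d -> 'M[R]_(p, q)) :
  cdiff r U f <-> forall i j, cdiff r U (fun x => f x i j).
Proof.
elim: r f => [|r IH] f.
  split=> [cf i j x Ux|cf x Ux]; last by apply: continuous_mx => i j; exact: cf.
  apply: (@continuous_comp _ _ _ f (fun N => N i j)); first exact: cf.
  exact: coord_continuous.
split=> [[df Df] i j|H].
  split=> [x Ux|v]; first by apply: differentiable_mx_coord; exact: df.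
  have /IH/(_ i j) := Df v; apply: cdiff_ext => x Ux.
  by rewrite derive_mx_coord//; exact: df.
have df x : U x -> differentiable f x.
  by move=> Ux; apply: differentiable_mx => i j; apply: (H i j).1.
split=> // v; apply/IH => i j.
have := (H i j).2 v; apply: cdiff_ext => x Ux.
by rewrite derive_mx_coord//; exact: df.
Qed.

End cdiff_class.

Section smooth_class.
Variables (R : realType) (d : nat) (U : set 'rV[R]_d).
Hypothesis oU : open U.
Implicit Types (x u v : 'rV[R]_d) (V : normedModType R).

Lemma smooth_differentiable V (f : 'rV[R]_d -> V) x :
  smooth U f -> U x -> differentiable f x.
Proof. by move=> /(_ 1%N)[df _]; exact: df. Qed.

Lemma smooth_continuous V (f : 'rV[R]_d -> V) x :
  smooth U f -> U x -> {for x, continuous f}.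
Proof. by move=> /(_ 0%N); apply. Qed.

Lemma smooth_derive V (f : 'rV[R]_d -> V) v :
  smooth U f -> smooth U (fun x => 'D_v f x).
Proof. by move=> sf r; have [_] := sf r.+1; apply. Qed.

Lemma smooth_ext V (f g : 'rV[R]_d -> V) :
  (forall y, U y -> f y = g y) -> smooth U f -> smooth U g.
Proof. by move=> fg sf r; exact: cdiff_ext (sf r). Qed.

Lemma smooth_cst V (a : V) : smooth U (fun=> a).
Proof. by move=> r; exact: cdiff_cst. Qed.

Lemma smoothD V (f g : 'rV[R]_d -> V) :
  smooth U f -> smooth U g -> smooth U (fun x => f x + g x).
Proof. by move=> sf sg r; exact: cdiffD. Qed.

Lemma smoothM (f g : 'rV[R]_d -> R) :
  smooth U f -> smooth U g -> smooth U (fun x => f x * g x).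
Proof. by move=> sf sg r; exact: cdiffM. Qed.

Lemma smoothV (f : 'rV[R]_d -> R) : (forall x, U x -> f x != 0) ->
  smooth U f -> smooth U (fun x => (f x)^-1).
Proof. by move=> f0 sf r; exact: cdiffV. Qed.

Lemma smooth_mxP p q (f : 'rV[R]_d -> 'M[R]_(p, q)) :
  smooth U f <-> forall i j, smooth U (fun x => f x i j).
Proof.
split=> [sf i j r|H r]; first exact: (cdiff_mxP oU r f).1.
by apply/cdiff_mxP => // i j; exact: H.
Qed.

Lemma smooth_mulmx p q s (f : 'rV[R]_d -> 'M[R]_(p, q))
    (g : 'rV[R]_d -> 'M[R]_(q, s)) :
  smooth U f -> smooth U g -> smooth U (fun x => f x *m g x).
Proof.
move=> /smooth_mxP sf /smooth_mxP sg; apply/smooth_mxP => i j r.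
under eq_fun do rewrite mxE.
by apply: cdiff_sum => // k _; apply: cdiffM => //; [exact: sf|exact: sg].
Qed.

Lemma smooth_trmx p q (f : 'rV[R]_d -> 'M[R]_(p, q)) :
  smooth U f -> smooth U (fun x => (f x)^T).
Proof.
move=> /smooth_mxP sf; apply/smooth_mxP => i j.
by under eq_fun do rewrite mxE; exact: sf.
Qed.

Lemma smooth_scalemx p q (k : 'rV[R]_d -> R) (f : 'rV[R]_d -> 'M[R]_(p, q)) :
  smooth U k -> smooth U f -> smooth U (fun x => k x *: f x).
Proof.
move=> sk /smooth_mxP sf; apply/smooth_mxP => i j.
by under eq_fun do rewrite mxE; apply: smoothM; last exact: sf.
Qed.

Lemma smooth_det p (f : 'rV[R]_d -> 'M[R]_p) :
  smooth U f -> smooth U (fun x => \det (f x)).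
Proof.
move=> /smooth_mxP sf r; apply: cdiff_sum => // s _.
apply: cdiffM => //; first exact: cdiff_cst.
by apply: cdiff_prod => // i _; exact: sf.
Qed.

(** By Cramer's formula, the inverse is rational in the entries. *)
Lemma smooth_invmx p (f : 'rV[R]_d -> 'M[R]_p) :
  (forall x, U x -> f x \in unitmx) ->
  smooth U f -> smooth U (fun x => invmx (f x)).
Proof.
move=> fu sf; apply: (@smooth_ext _ (fun x => (\det (f x))^-1 *: \adj (f x))).
  by move=> x Ux; rewrite /invmx fu.
apply: smooth_scalemx.
  apply: smoothV; last exact: smooth_det.
  by move=> x /fu; rewrite unitmxE unitfE.
apply/smooth_mxP => i j; under eq_fun do rewrite mxE.
apply: smoothM; first exact: smooth_cst.
apply: smooth_det; apply/smooth_mxP => k l; under eq_fun do rewrite !mxE.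
by move/smooth_mxP : sf; exact.
Qed.

End smooth_class.

Section smooth_composition.
Variables (R : realType) (k d : nat) (V : set 'rV[R]_k) (U : set 'rV[R]_d).
Hypotheses (oV : open V) (oU : open U).
Variable F : 'rV[R]_k -> 'rV[R]_d.
Hypotheses (sF : smooth V F) (FVU : forall y, V y -> U (F y)).

(** The partial derivatives of g o F are sums of products of the derivatives of F
    and of composites with F, to which the induction on the order applies. *)
Lemma smooth_comp_scalar (g : 'rV[R]_d -> R) : smooth U g -> smooth V (g \o F).
Proof.
move=> sg r; elim: r g sg => [|r IH] g sg.
  move=> y Vy; apply: continuous_comp; first exact: smooth_continuous sF Vy.
  exact: smooth_continuous sg (FVU Vy).
split=> [y Vy|v].
  apply: differentiable_comp; first exact: smooth_differentiable sF Vy.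
  exact: smooth_differentiable sg (FVU Vy).
apply: (@cdiff_ext _ _ _ oV _ _ (fun y => \sum_j 'D_v F y 0 j *
   ((fun x => 'D_(delta_mx 0 j) g x) \o F) y)).
  move=> y Vy; have dF := smooth_differentiable sF Vy.
  have dg := smooth_differentiable sg (FVU Vy).
  by rewrite [RHS](derive_comp _ dF dg) [RHS]derive_dir_sum.
apply: cdiff_sum => // j _; apply: cdiffM => //.
  exact: ((smooth_mxP oV _).1 (smooth_derive v sF)).
exact: IH (smooth_derive _ sg).
Qed.

Lemma smooth_comp p q (g : 'rV[R]_d -> 'M[R]_(p, q)) :
  smooth U g -> smooth V (g \o F).
Proof.
move=> /(smooth_mxP oU) sg; apply/(smooth_mxP oV) => i j.
exact: smooth_comp_scalar (sg i j).
Qed.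

End smooth_composition.

Section derivative_rules.
Variables (R : realType) (V : normedModType R).
Implicit Types x v : V.

Lemma differentiable_mulmx p q s (f : V -> 'M[R]_(p, q)) (g : V -> 'M[R]_(q, s)) x :
  differentiable f x -> differentiable g x ->
  differentiable (fun y => f y *m g y) x.
Proof.
move=> df dg; apply: differentiable_mx => i j.
rewrite (_ : (fun y => _) = \sum_k ((fun y => f y i k) * (fun y => g y k j))).
  by apply: differentiable_sum => k; apply: differentiableM;
    exact: differentiable_mx_coord.
by apply/funext => y; rewrite fct_sumE mxE.
Qed.

Lemma derive_mulmx p q s (f : V -> 'M[R]_(p, q)) (g : V -> 'M[R]_(q, s)) x v :
  differentiable f x -> differentiable g x ->
  'D_v (fun y => f y *m g y) x = 'D_v f x *m g x + f x *m 'D_v g x.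
Proof.
move=> df dg; apply/matrixP => i j.
rewrite derive_mx_coord; last exact: differentiable_mulmx.
rewrite (_ : (fun y => _) = \sum_k ((fun y => f y i k) * (fun y => g y k j))).
  have dfk k : derivable (fun y => f y i k) x v.
    exact/diff_derivable/differentiable_mx_coord.
  have dgk k : derivable (fun y => g y k j) x v.
    exact/diff_derivable/differentiable_mx_coord.
  rewrite derive_sum => [|k]; last exact: derivableM.
  rewrite !mxE -big_split; apply: eq_bigr => k _ /=.
  rewrite deriveM// !derive_mx_coord// addrC; congr (_ + _).
  by rewrite /GRing.scale /= mulrC.
by apply/funext => y; rewrite fct_sumE mxE.
Qed.

Lemma derive_mulmxr p q s (A : 'M[R]_(p, q)) (g : V -> 'M[R]_(q, s)) x v :
  differentiable g x -> 'D_v (fun y => A *m g y) x = A *m 'D_v g x.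
Proof.
move=> dg; rewrite (@derive_mulmx _ _ _ (fun=> A))//.
by rewrite derive_cst mul0mx add0r.
Qed.

Lemma derive_mulmxl p q s (A : 'M[R]_(q, s)) (g : V -> 'M[R]_(p, q)) x v :
  differentiable g x -> 'D_v (fun y => g y *m A) x = 'D_v g x *m A.
Proof.
move=> dg; rewrite (@derive_mulmx _ _ _ g (fun=> A))//.
by rewrite derive_cst mulmx0 addr0.
Qed.

Lemma derive_scalemx p q (a : V -> R) (f : V -> 'M[R]_(p, q)) x v :
  differentiable a x -> differentiable f x ->
  'D_v (fun y => a y *: f y) x = 'D_v a x *: f x + a x *: 'D_v f x.
Proof.
move=> da df.
have daf : differentiable (fun y => a y *: f y) x.
  apply: differentiable_mx => i j; under eq_fun do rewrite mxE.
  by apply: differentiableM => //; exact: differentiable_mx_coord.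
apply/matrixP => i j; rewrite derive_mx_coord// !mxE derive_mx_coord//.
have dav : derivable a x v by exact: diff_derivable.
have dfv : derivable (fun y => f y i j) x v.
  exact/diff_derivable/differentiable_mx_coord.
under eq_fun do rewrite mxE.
rewrite [LHS](deriveM dav dfv) addrC; congr (_ + _).
by rewrite /GRing.scale /= mulrC.
Qed.

Lemma differentiable_trmx p q (f : V -> 'M[R]_(p, q)) x :
  differentiable f x -> differentiable (fun y => (f y)^T) x.
Proof.
move=> df; apply: differentiable_mx => i j; under eq_fun do rewrite mxE.
exact: differentiable_mx_coord.
Qed.

Lemma derive_trmx p q (f : V -> 'M[R]_(p, q)) x v :
  differentiable f x -> 'D_v (fun y => (f y)^T) x = ('D_v f x)^T.
Proof.
move=> df; apply/matrixP => i j; rewrite derive_mx_coord; last first.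
  exact: differentiable_trmx.
by rewrite mxE derive_mx_coord//; congr ('D_v _ x); apply/funext => y; rewrite mxE.
Qed.

End derivative_rules.

(** * Symmetry of second derivatives *)

Section second_derivatives.
Variables (R : realType) (d : nat).
Implicit Types (U : set 'rV[R]_d) (x u v : 'rV[R]_d).

Lemma is_derive_line (V : normedModType R) (f : V -> R) (x u : V) s :
  differentiable f (x + s *: u) ->
  is_derive s 1 (fun t => f (x + t *: u)) ('D_u f (x + s *: u)).
Proof.
move=> df; pose l t : V := x + t *: u.
have dsc : differentiable (fun t : R => t *: u) s by exact: differentiableZl.
have Dl : differentiable l s by exact: differentiableD.
have D1l : 'D_1 l s = u.
  rewrite [LHS](@deriveD _ _ _ (cst x) (fun t : R => t *: u))//; first last.
    exact: diff_derivable.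
  by rewrite derive_cst add0r deriveE// diffZl// diff_val scale1r.
apply: DeriveDef; first exact/derivable1_diffP/(@differentiable_comp _ _ _ _ l f).
by rewrite (@derive_comp _ _ _ _ l f)// D1l.
Qed.

Lemma line_mvt (V : normedModType R) (f : V -> R) (x u : V) :
  (forall t : R, 0 <= t <= 1 -> differentiable f (x + t *: u)) ->
  exists2 t : R, 0 < t < 1 & f (x + u) - f x = 'D_u f (x + t *: u).
Proof.
move=> df.
have D (t : R) : 0 <= t <= 1 ->
    is_derive t 1 (fun t => f (x + t *: u)) ('D_u f (x + t *: u)).
  by move=> /df; exact: is_derive_line.
have [||t] := @MVT R (fun t : R => f (x + t *: u)) (fun t : R => 'D_u f (x + t *: u)) 0 1 ltr01.
- by move=> t; rewrite in_itv/= => /andP[/ltW t0 /ltW t1]; apply: D; rewrite t0.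
- apply: continuous_in_subspaceT => t; rewrite inE/= in_itv/= => /D[dt _].
  exact/differentiable_continuous/derivable1_diffP.
by rewrite in_itv/= scale1r scale0r addr0 subr0 mulr1; exists t.
Qed.

(** Two applications of the mean value theorem, first to the difference of f along
    two opposite sides of a parallelogram and then to its derivative. *)
Lemma second_difference (V : normedModType R) (U : set V) (f : V -> R)
    (x u v : V) :
  (forall y, U y -> differentiable f y) ->
  (forall y, U y -> differentiable ('D_u f) y) ->
  (forall s t : R, 0 <= s <= 1 -> 0 <= t <= 1 -> U (x + s *: u + t *: v)) ->
  exists s t : R, [/\ 0 <= s <= 1, 0 <= t <= 1 &
    f (x + u + v) - f (x + u) - (f (x + v) - f x) =
    'D_v ('D_u f) (x + s *: u + t *: v)].
Proof.
move=> df dDf xU.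
have i0 : 0 <= (0 : R) <= 1 by rewrite lexx ler01.
have i1 : 0 <= (1 : R) <= 1 by rewrite ler01 lexx.
pose h (s : R) := f (x + v + s *: u) - f (x + s *: u).
have dh (s : R) : 0 <= s <= 1 ->
    is_derive s 1 h ('D_u f (x + v + s *: u) - 'D_u f (x + s *: u)).
  move=> s01; apply: is_deriveB; apply: is_derive_line; apply: df.
    by rewrite addrAC -[v]scale1r; exact: xU.
  by rewrite -[x + _]addr0 -(scale0r v); exact: xU.
have [||s] := @MVT R h (fun s : R => 'D_u f (x + v + s *: u) - 'D_u f (x + s *: u)) 0 1 ltr01.
- by move=> s; rewrite in_itv/= => /andP[/ltW s0 /ltW s1]; apply: dh; rewrite s0.
- apply: continuous_in_subspaceT => s; rewrite inE/= in_itv/= => /dh[ds _].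
  exact/differentiable_continuous/derivable1_diffP.
rewrite in_itv/= => /andP[/ltW s0 /ltW s1]; rewrite subr0 mulr1.
have s01 : 0 <= s <= 1 by rewrite s0.
rewrite /h !scale1r !scale0r !addr0 => hs.
have [t /andP[/ltW t0 /ltW t1] ht] : exists2 t : R, 0 < t < 1 &
    'D_u f (x + s *: u + v) - 'D_u f (x + s *: u) =
    'D_v ('D_u f) (x + s *: u + t *: v).
  by apply: (@line_mvt V ('D_u f)) => t t01; exact/dDf/xU.
exists s, t; split=> //; first by rewrite t0.
by rewrite -ht (addrAC x (s *: u)) -hs (addrAC x u); ring.
Qed.

(** Schwarz's theorem: the second difference above is symmetric in the two
    sides, and it computes both mixed derivatives as the parallelogram shrinks
    to a point. *)
Lemma derive_comm_scalar (U : set 'rV[R]_d) (f : 'rV[R]_d -> R) x u v :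
  open U -> smooth U f -> U x -> 'D_u ('D_v f) x = 'D_v ('D_u f) x.
Proof.
move=> oU sf Ux.
apply/eqP; rewrite -subr_eq0 -normr_le0; apply/ler_addgt0Pl => e e0.
rewrite addr0.
have e20 : 0 < e / 2 by rewrite divr_gt0.
have c1 := smooth_continuous (smooth_derive u (smooth_derive v sf)) Ux.
have c2 := smooth_continuous (smooth_derive v (smooth_derive u sf)) Ux.
move/cvgrPdist_lt/(_ _ e20) : c1 => c1.
move/cvgrPdist_lt/(_ _ e20) : c2 => c2.
have Ux' : nbhs x U by exact: open_nbhs_nbhs.
have [r xr] := nbhs_ex (filterI Ux' (filterI c1 c2)).
clear c1 c2 Ux'.
pose c := `|u| + `|v| + 1.
have c0 : 0 < c by rewrite /c ltr_wpDl// addr_ge0.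
(* The parallelogram with sides h u and h v lies in the ball of radius r. *)
have [h [h0 hc]] : exists h : R, 0 < h /\ h * c < r%:num.
  exists (r%:num / c / 2); split; first by rewrite !divr_gt0.
  by rewrite mulrAC divfK ?gt_eqF// ltr_pdivrMr// ltr_pMr// ltr1n.
have hr (a b : R) : `|a| <= 1 -> `|b| <= 1 -> ball x r%:num (x + a *: (h *: u) + b *: (h *: v)).
  move=> a1 b1; rewrite -ball_normE/= -addrA opprD addrA subrr add0r normrN.
  rewrite (le_lt_trans (ler_normD _ _))//.
  rewrite !normrZ (gtr0_norm h0).
  rewrite (@le_lt_trans _ _ (h * c))//.
  rewrite /c !mulrDr mulr1 -addrA lerD//; first by rewrite ler_piMl// mulr_ge0// ltW.
  by rewrite (@le_trans _ _ (h * `|v|)) ?lerDl// ?ler_piMl// ?mulr_ge0// ltW.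
have n1 (s : R) : 0 <= s <= 1 -> `|s| <= 1.
  by move=> /andP[s0 s1]; rewrite ger0_norm.
have df y : U y -> differentiable f y by exact: smooth_differentiable.
have dDf y w : U y -> differentiable ('D_w f) y.
  exact: smooth_differentiable (smooth_derive w sf).
have scale2 (a b : 'rV[R]_d) y : U y ->
    'D_(h *: b) ('D_(h *: a) f) y = h * h * 'D_b ('D_a f) y.
  move=> Uy; rewrite derive_dirZ; last exact: dDf.
  have -> : 'D_b ('D_(h *: a) f) y = 'D_b (h \*: 'D_a f) y.
    apply: (@derive_ext _ _ _ oU) Uy => z Uz.
    by rewrite derive_dirZ//; exact: df.
  rewrite deriveZ; last exact/diff_derivable/dDf.
  by rewrite /GRing.scale/= mulrA.
have box (a b : R) : `|a| <= 1 -> `|b| <= 1 -> U (x + a *: (h *: u) + b *: (h *: v)).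
  by move=> a1 b1; have [] := xr _ (hr _ _ a1 b1).
have [s1 [t1 [/n1 s11 /n1 t11 E1]]] : exists s t : R, [/\ 0 <= s <= 1, 0 <= t <= 1 &
    f (x + h *: u + h *: v) - f (x + h *: u) - (f (x + h *: v) - f x) =
    'D_(h *: v) ('D_(h *: u) f) (x + s *: (h *: u) + t *: (h *: v))].
  apply: (@second_difference _ U) => // [y|s t /n1 ? /n1 ?]; first exact: dDf.
  exact: box.
have [t2 [s2 [/n1 t21 /n1 s21 E2]]] : exists t s : R, [/\ 0 <= t <= 1, 0 <= s <= 1 &
    f (x + h *: v + h *: u) - f (x + h *: v) - (f (x + h *: u) - f x) =
    'D_(h *: u) ('D_(h *: v) f) (x + t *: (h *: v) + s *: (h *: u))].
  apply: (@second_difference _ U) => // [y|s t /n1 ? /n1 ?]; first exact: dDf.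
  by rewrite addrAC; exact: box.
have {}E1 := etrans E1 (scale2 u v _ (box _ _ s11 t11)).
rewrite (addrAC x (t2 *: _)) in E2.
have {}E2 := etrans E2 (scale2 v u _ (box _ _ s21 t21)).
have [_ [_ B1]] := xr _ (hr _ _ s11 t11).
have [_ [B2 _]] := xr _ (hr _ _ s21 t21).
have E : 'D_v ('D_u f) (x + s1 *: (h *: u) + t1 *: (h *: v)) =
         'D_u ('D_v f) (x + s2 *: (h *: u) + t2 *: (h *: v)).
  apply: (mulfI (lt0r_neq0 (mulr_gt0 h0 h0))).
  apply: etrans (esym E1) (etrans _ E2).
  by rewrite (addrAC x (h *: v)); ring.
rewrite E distrC in B1.
rewrite -(subrKA ('D_u ('D_v f) (x + s2 *: (h *: u) + t2 *: (h *: v)))).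
apply: le_trans (ler_normD _ _) _.
by rewrite [leRHS]splitr; exact: lerD (ltW B2) (ltW B1).
Qed.

Lemma derive_comm p q (U : set 'rV[R]_d) (f : 'rV[R]_d -> 'M[R]_(p, q)) x u v :
  open U -> smooth U f -> U x -> 'D_u ('D_v f) x = 'D_v ('D_u f) x.
Proof.
move=> oU sf Ux; apply/matrixP => i j.
have sfij : smooth U (fun y => f y i j) by move/(smooth_mxP oU): sf; apply.
have E a b : ('D_a ('D_b f) x) i j = 'D_a ('D_b (fun y => f y i j)) x.
  rewrite derive_mx_coord; last exact: smooth_differentiable (smooth_derive b sf) Ux.
  apply: (@derive_ext _ _ _ oU) Ux => y Uy.
  by rewrite derive_mx_coord//; exact: smooth_differentiable Uy.
exact: etrans (E u v) (etrans (derive_comm_scalar u v oU sfij Ux) (esym (E v u))).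
Qed.

End second_derivatives.

(** * Inner products in coordinates *)

Ltac ring_atoms :=
  repeat match goal with
  | |- context [ip ?G ?u ?v] => move: (ip G u v) => ?
  | |- context [fun_of_matrix ?A ?i ?j] => move: (fun_of_matrix A i j) => ?
  end; ring.

Section inner_product.
Variables (R : realType) (d : nat).
Implicit Types (G A : 'M[R]_d) (u v w : 'rV[R]_d).

Lemma mxDE p q (A B : 'M[R]_(p, q)) i j : (A + B) i j = A i j + B i j.
Proof. by rewrite mxE. Qed.

Lemma mxNE p q (A : 'M[R]_(p, q)) i j : (- A) i j = - A i j.
Proof. by rewrite mxE. Qed.

Lemma mxZE p q a (A : 'M[R]_(p, q)) i j : (a *: A) i j = a * A i j.
Proof. by rewrite mxE. Qed.

Lemma mx0E p q i j : (0 : 'M[R]_(p, q)) i j = 0.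
Proof. by rewrite mxE. Qed.

Definition mx_entryE := (mxDE, mxNE, mxZE, mx0E).

Lemma ipDl G u v w : ip G (u + v) w = ip G u w + ip G v w.
Proof. by rewrite /ip !mulmxDl mxDE. Qed.

Lemma ipDr G u v w : ip G u (v + w) = ip G u v + ip G u w.
Proof. by rewrite /ip linearD mulmxDr mxDE. Qed.

Lemma ipZl G a u v : ip G (a *: u) v = a * ip G u v.
Proof. by rewrite /ip -!scalemxAl mxZE. Qed.

Lemma ipZr G a u v : ip G u (a *: v) = a * ip G u v.
Proof. by rewrite /ip linearZ -scalemxAr mxZE. Qed.

Lemma ipNl G u v : ip G (- u) v = - ip G u v.
Proof. by rewrite -scaleN1r ipZl mulN1r. Qed.

Lemma ipNr G u v : ip G u (- v) = - ip G u v.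
Proof. by rewrite -scaleN1r ipZr mulN1r. Qed.

Lemma ip0l G u : ip G 0 u = 0.
Proof. by rewrite /ip !mul0mx mxE. Qed.

Lemma ipC G u v : G^T = G -> ip G u v = ip G v u.
Proof.
move=> GT; have -> : ip G u v = ((v *m G *m u^T)^T) 0 0.
  by rewrite !trmx_mul trmxK GT mulmxA.
by rewrite mxE.
Qed.

Lemma posdef_unit G : (forall u, u != 0 -> 0 < ip G u u) -> G \in unitmx.
Proof.
move=> Gpos; rewrite -row_free_unit; apply: inj_row_free => v vG0.
by apply/eqP; apply: contraPT vG0 => /Gpos + vG0; rewrite /ip vG0 mul0mx mxE ltxx.
Qed.

Lemma ip_inj G u v : G \in unitmx -> (forall w, ip G u w = ip G v w) -> u = v.
Proof.
move=> Gu uv; apply: (can_inj (mulmxK Gu)); apply/rowP => k.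
by have := uv (delta_mx 0 k); rewrite /ip trmx_delta -!colE !mxE.
Qed.

Lemma ip_mx_inj (A B : 'M[R]_d) : (forall u v, ip A u v = ip B u v) -> A = B.
Proof.
move=> AB; apply/matrixP => i j.
have := AB (delta_mx 0 i) (delta_mx 0 j).
by rewrite /ip trmx_delta -!colE -!rowE !mxE.
Qed.

(** The orthogonal complement of the span of s. *)
Definition perp_mx G (s : seq 'rV[R]_d) : 'M[R]_d :=
  kermx (G *m (\matrix_(i < size s) nth 0 s i)^T).

Lemma perp_mxP G (s : seq 'rV[R]_d) v :
  reflect (forall w, w \in s -> ip G v w = 0) (v <= perp_mx G s)%MS.
Proof.
have ipE' i (si : (i < size s)%N) : ip G v (nth 0 s i) =
    (v *m (G *m (\matrix_(i < size s) nth 0 s i)^T)) 0 (Ordinal si).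
  have -> : nth 0 s i = row (Ordinal si) (\matrix_(i < size s) nth 0 s i).
    by rewrite rowK.
  by rewrite /ip tr_row colE !mulmxA -colE mxE.
apply: (iffP sub_kermxP) => [v0 w /(nthP 0)[i si <-]|v0].
  by rewrite ipE' v0 mxE.
by apply/rowP => -[i si]; rewrite -ipE' mxE v0// mem_nth.
Qed.

Lemma rank_perp_mx G (s : seq 'rV[R]_d) : (d - size s <= \rank (perp_mx G s))%N.
Proof. by rewrite mxrank_ker leq_sub2l// rank_leq_col. Qed.

Lemma exists_orthogonal G (s : seq 'rV[R]_d) : (size s < d)%N ->
  exists2 u : 'rV[R]_d, u != 0 & forall v, v \in s -> ip G u v = 0.
Proof.
move=> sd; have : perp_mx G s != 0.
  by rewrite -mxrank_eq0 -lt0n (leq_trans _ (rank_perp_mx G s))// subn_gt0.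
by move=> /rowV0Pn[u /perp_mxP us u0]; exists u.
Qed.

End inner_product.

Lemma trmxD (R : realType) p q (A B : 'M[R]_(p, q)) : (A + B)^T = A^T + B^T.
Proof. exact: linearD. Qed.

Lemma trmxN (R : realType) p q (A : 'M[R]_(p, q)) : (- A)^T = - A^T.
Proof. exact: linearN. Qed.

Ltac mx_ring :=
  rewrite ?(trmxD, trmxN, trmx_mul, trmxK);
  rewrite ?(mulmxDl, mulmxDr, mulNmx, mulmxN);
  rewrite -?scalemxAl -?scalemxAr ?mulmxA;
  apply/matrixP => ? ?; rewrite ?mx_entryE; ring_atoms.

(** * The Levi-Civita connection at a point *)

(** Here G is the metric at a point and D u its derivative in the direction u,
    so that the whole construction of the connection is linear algebra. *)
Section koszul_formula.
Variables (R : realType) (d : nat) (G : 'M[R]_d) (D : 'rV[R]_d -> 'M[R]_d).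
Hypotheses (Gpos : forall u, u != 0 -> 0 < ip G u u).
Hypotheses (DT : forall u, (D u)^T = D u).
Hypotheses (D_lin : forall a u v, D (a *: u + v) = a *: D u + D v).
Implicit Types (u v w z : 'rV[R]_d).

Let Gunit : G \in unitmx. Proof. exact: posdef_unit. Qed.

Definition koszul_form u v w : R :=
  2^-1 * (ip (D u) v w + ip (D v) u w - ip (D w) u v).

Definition koszul_vector u v : 'rV[R]_d :=
  (\row_k koszul_form u v (delta_mx 0 k)) *m invmx G.

Lemma ip_lin_mx (A B : 'M[R]_d) a u v : ip (a *: A + B) u v = a * ip A u v + ip B u v.
Proof. by rewrite /ip mulmxDr mulmxDl mxDE -scalemxAr -scalemxAl mxZE. Qed.

Lemma koszul_form_linr a u v v' w :
  koszul_form u (a *: v + v') w = a * koszul_form u v w + koszul_form u v' w.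
Proof.
rewrite /koszul_form D_lin ip_lin_mx !ipDl !ipDr ipZr ipZl; ring_atoms.
Qed.

Lemma koszul_formC u v w : koszul_form u v w = koszul_form v u w.
Proof. by rewrite /koszul_form (ipC u v (DT w)); ring_atoms. Qed.

Lemma koszul_form_lin3 a u v w z :
  koszul_form u v (a *: w + z) = a * koszul_form u v w + koszul_form u v z.
Proof.
by rewrite /koszul_form D_lin ip_lin_mx !ipDr !ipZr; ring_atoms.
Qed.

Lemma koszul_form_sum u v w :
  koszul_form u v w = \sum_k w 0 k * koszul_form u v (delta_mx 0 k).
Proof.
rewrite {1}(row_sum_delta w).
have k0 : koszul_form u v 0 = 0.
  by have := koszul_form_lin3 (-1) u v 0 0; rewrite scaler0 addr0 mulN1r addNr.
by elim/big_rec2 : _ => // k a b _ <-; exact: koszul_form_lin3.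
Qed.

Lemma koszul_vector_ip u v w : ip G (koszul_vector u v) w = koszul_form u v w.
Proof.
rewrite /ip /koszul_vector mulmxKV// koszul_form_sum mxE.
by apply: eq_bigr => k _; rewrite !mxE mulrC.
Qed.

(** The torsion of the Levi-Civita connection vanishes. *)
Lemma koszul_vectorC u v : koszul_vector u v = koszul_vector v u.
Proof.
by apply: (ip_inj Gunit) => w; rewrite !koszul_vector_ip koszul_formC.
Qed.

Lemma koszul_vector_linr a u v w :
  koszul_vector u (a *: v + w) = a *: koszul_vector u v + koszul_vector u w.
Proof.
apply: (ip_inj Gunit) => z.
by rewrite ipDl ipZl !koszul_vector_ip koszul_form_linr.
Qed.

(** The connection form: the covariant derivative of a field w in the direction
    u is the derivative of w plus w *m koszul_mx u. *)
Definition koszul_mx u : 'M[R]_d :=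
  \matrix_i koszul_vector u (delta_mx 0 i).

Lemma koszul_vectorE u v : koszul_vector u v = v *m koszul_mx u.
Proof.
rewrite mulmx_sum_row {1}(row_sum_delta v).
under [in RHS]eq_bigr do rewrite rowK.
have c0 : koszul_vector u 0 = 0.
  by have := koszul_vector_linr (-1) u 0 0; rewrite scaler0 addr0 scaleN1r addNr.
by elim/big_rec2 : _ => // k a b _ <-; exact: koszul_vector_linr.
Qed.

Lemma koszul_mxC u v : u *m koszul_mx v = v *m koszul_mx u.
Proof. by rewrite -!koszul_vectorE koszul_vectorC. Qed.

Lemma koszul_mx_lin a u v :
  koszul_mx (a *: u + v) = a *: koszul_mx u + koszul_mx v.
Proof.
apply/row_matrixP => i; rewrite !linearD linearZ /= !rowK.
by rewrite koszul_vectorC koszul_vector_linr !(koszul_vectorC (delta_mx 0 i)).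
Qed.

(** The metric is parallel: in the sum of the two Koszul forms, the derivatives of
    the metric in the directions v and w cancel. *)
Lemma koszul_mx_metric u : G^T = G ->
  D u = koszul_mx u *m G + G *m (koszul_mx u)^T.
Proof.
move=> GT; apply: ip_mx_inj => v w.
have -> : ip (koszul_mx u *m G + G *m (koszul_mx u)^T) v w =
    ip G (koszul_vector u v) w + ip G v (koszul_vector u w).
  by rewrite !koszul_vectorE /ip trmx_mul mulmxDr mulmxDl mxDE !mulmxA.
rewrite [ip G v _](ipC _ _ GT) !koszul_vector_ip /koszul_form.
rewrite (ipC w v (DT u)).
set a := ip (D u) v w; set b := ip (D v) u w; set c := ip (D w) u v.
by field.
Qed.

End koszul_formula.

(** * The curvature at a point *)

(** Here A u is the connection form in the direction u, DA u v the derivative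
    of A v in the direction u, and DDA w u v that of DA u v in the direction
    w. *)
Section curvature_algebra.
Variables (R : realType) (d : nat).
Implicit Types (u v w z : 'rV[R]_d) (A : 'rV[R]_d -> 'M[R]_d).
Implicit Types (DA : 'rV[R]_d -> 'rV[R]_d -> 'M[R]_d).

Definition curv_mx A DA u v : 'M[R]_d :=
  DA u v - DA v u + A v *m A u - A u *m A v.

Lemma curv_mx_anti A DA u v : curv_mx A DA u v = - curv_mx A DA v u.
Proof. by rewrite /curv_mx; mx_ring. Qed.

Lemma curv_mx_linl A DA a u v w :
  (forall a u v, A (a *: u + v) = a *: A u + A v) ->
  (forall a u v w, DA (a *: u + v) w = a *: DA u w + DA v w) ->
  (forall a u v w, DA w (a *: u + v) = a *: DA w u + DA w v) ->
  curv_mx A DA (a *: u + v) w = a *: curv_mx A DA u w + curv_mx A DA v w.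
Proof. by move=> lA lD lD'; rewrite /curv_mx lA lD lD'; mx_ring. Qed.

(** The first Bianchi identity expresses that the torsion vanishes, which is the
    symmetry of u *m A v and, after differentiation, of u *m DA z v. *)
Lemma bianchi1 A DA u v w :
  (forall u v, u *m A v = v *m A u) ->
  (forall z u v, u *m DA z v = v *m DA z u) ->
  w *m curv_mx A DA u v + u *m curv_mx A DA v w + v *m curv_mx A DA w u = 0.
Proof.
move=> AC DAC; rewrite /curv_mx !(mulmxDr, mulmxN, mulmxA).
rewrite (AC w v) (AC w u) (AC u v) (DAC u w v) (DAC v w u) (DAC w u v).
by mx_ring.
Qed.

(** Differentiating the metric twice: the second hypothesis is the symmetry of its
    second derivatives, computed from the first one. *)
Lemma curv_mx_skew A DA (G : 'M[R]_d) (D : 'rV[R]_d -> 'M[R]_d) u v :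
  (forall u, D u = A u *m G + G *m (A u)^T) ->
  DA u v *m G + A v *m D u + D u *m (A v)^T + G *m (DA u v)^T =
  DA v u *m G + A u *m D v + D v *m (A u)^T + G *m (DA v u)^T ->
  curv_mx A DA u v *m G = - (G *m (curv_mx A DA u v)^T).
Proof.
move=> DE /eqP; rewrite -subr_eq0 => /eqP E.
apply/eqP; rewrite -subr_eq0 opprK -[X in _ == X]E; apply/eqP.
by rewrite /curv_mx !DE; mx_ring.
Qed.

(** The second Bianchi identity: the second derivatives of A cancel because they are
    symmetric, and the remaining terms cancel by Jacobi's identity. *)
Lemma bianchi2 A DA (DDA : 'rV[R]_d -> 'rV[R]_d -> 'rV[R]_d -> 'M[R]_d)
    (DF : 'rV[R]_d -> 'rV[R]_d -> 'rV[R]_d -> 'M[R]_d) u v w :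
  (forall w u v, DDA w u v = DDA u w v) ->
  (forall w u v, DF w u v = DDA w u v - DDA w v u
    + (DA w v *m A u + A v *m DA w u) - (DA w u *m A v + A u *m DA w v)) ->
  let nablaF w u v :=
    DF w u v + curv_mx A DA u v *m A w - A w *m curv_mx A DA u v in
  nablaF w u v + nablaF u v w + nablaF v w u = 0.
Proof.
move=> DC DFE /=; rewrite !DFE /curv_mx (DC w u v) (DC w v u) (DC u v w).
by mx_ring.
Qed.

(** The curvature operator of constant curvature 1. *)
Definition wedge_mx (G : 'M[R]_d) u v : 'M[R]_d := G *m (v^T *m u - u^T *m v).

Lemma wedge_mxE (G : 'M[R]_d) u v z :
  z *m wedge_mx G u v = ip G z v *: u - ip G z u *: v.
Proof.
rewrite /wedge_mx /ip mulmxBr mulmxBr !mulmxA.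
by rewrite (mx11_scalar (z *m G *m v^T)) (mx11_scalar (z *m G *m u^T)) !mul_scalar_mx !mxE.
Qed.

(** The metric is parallel and the torsion vanishes, so the constant curvature 1
    operator has the cyclic symmetry that the second Bianchi identity asks for. *)
Lemma bianchi2_wedge A (G : 'M[R]_d) (D : 'rV[R]_d -> 'M[R]_d) u v w :
  (forall u v, u *m A v = v *m A u) ->
  (forall u, D u = A u *m G + G *m (A u)^T) ->
  let nablaS w u v := D w *m (v^T *m u - u^T *m v)
     + wedge_mx G u v *m A w - A w *m wedge_mx G u v in
  nablaS w u v + nablaS u v w + nablaS v w u = 0.
Proof.
move=> AC DE /=.
have AT a b : (A a)^T *m b^T = (A b)^T *m a^T by rewrite -!trmx_mul AC.
have E a b c : D a *m (c^T *m b - b^T *m c)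
     + wedge_mx G b c *m A a - A a *m wedge_mx G b c =
   G *m ((A a)^T *m c^T *m b - (A a)^T *m b^T *m c + c^T *m (b *m A a)
         - b^T *m (c *m A a)).
  by rewrite DE /wedge_mx; mx_ring.
rewrite !E (AT w v) (AT u w) (AT v u) (AC u w) (AC v w) (AC v u).
by mx_ring.
Qed.

(** The covariant derivatives of a S, summed cyclically, leave only the terms
    in which the factor a is differentiated. *)
Lemma cyclic_leibniz (a b1 b2 b3 : R) (S1 S2 S3 D1 D2 D3 A1 A2 A3 : 'M[R]_d) :
  b1 *: S1 + a *: D1 + (a *: S1) *m A1 - A1 *m (a *: S1)
  + (b2 *: S2 + a *: D2 + (a *: S2) *m A2 - A2 *m (a *: S2))
  + (b3 *: S3 + a *: D3 + (a *: S3) *m A3 - A3 *m (a *: S3)) = 0 ->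
  D1 + S1 *m A1 - A1 *m S1 + (D2 + S2 *m A2 - A2 *m S2)
  + (D3 + S3 *m A3 - A3 *m S3) = 0 ->
  b1 *: S1 + b2 *: S2 + b3 *: S3 = 0.
Proof.
move=> E1 E2; rewrite -[RHS]E1 -[LHS]addr0 -(scaler0 _ a) -E2.
by mx_ring.
Qed.

End curvature_algebra.

(** * The Levi-Civita connection of a smooth metric *)

Section smooth_ip.
Variables (R : realType) (d : nat) (U : set 'rV[R]_d).
Hypothesis oU : open U.

Lemma smooth_ip p (G : 'rV[R]_d -> 'M[R]_p) (u v : 'rV[R]_d -> 'rV[R]_p) :
  smooth U G -> smooth U u -> smooth U v -> smooth U (fun x => ip (G x) (u x) (v x)).
Proof.
move=> sG su sv; have := smooth_mulmx oU (smooth_mulmx oU su sG) (smooth_trmx oU sv).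
by move=> /(smooth_mxP oU)/(_ 0 0).
Qed.

Lemma smoothB (f h : 'rV[R]_d -> R) :
  smooth U f -> smooth U h -> smooth U (fun x => f x - h x).
Proof.
move=> sf sh; apply: smoothD => //.
apply: (@smooth_ext _ _ _ oU _ (fun x => -1 * h x)); first by move=> y _; rewrite mulN1r.
by apply: smoothM => //; exact: smooth_cst.
Qed.

End smooth_ip.

Section derivative_of_combination.
Variables (R : realType) (V W : normedModType R).

Lemma differentiable_lin (f h : V -> W) a x : differentiable f x -> differentiable h x ->
  differentiable (fun y => a *: f y + h y) x.
Proof. by move=> df dh; apply: differentiableD => //; exact: differentiableZ. Qed.

Lemma derive_lin (f h : V -> W) a x v : differentiable f x -> differentiable h x ->
  'D_v (fun y => a *: f y + h y) x = a *: 'D_v f x + 'D_v h x.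
Proof.
move=> df dh; have dfv : derivable f x v by exact: diff_derivable.
have dhv : derivable h x v by exact: diff_derivable.
by rewrite [LHS](@deriveD _ _ _ (a \*: f) h _ _ (derivableZ dfv) dhv) (deriveZ _ dfv).
Qed.

End derivative_of_combination.

Section levi_civita.
Variables (R : realType) (d : nat) (U : set 'rV[R]_d) (g : 'rV[R]_d -> 'M[R]_d).
Hypotheses (oU : open U) (sg : smooth U g).
Hypothesis gT : forall x, U x -> (g x)^T = g x.
Hypothesis gpos : forall x, U x -> forall u, u != 0 -> 0 < ip (g x) u u.
Implicit Types (x u v w z : 'rV[R]_d).

Let dg x : U x -> differentiable g x.
Proof. exact: smooth_differentiable. Qed.

Definition dmetric x u : 'M[R]_d := 'D_u g x.

Lemma dmetricT x u : U x -> (dmetric x u)^T = dmetric x u.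
Proof.
move=> Ux; rewrite /dmetric -derive_trmx; last exact: dg.
exact: (@derive_ext _ _ _ oU).
Qed.

Lemma dmetric_lin x : U x ->
  forall a u v, dmetric x (a *: u + v) = a *: dmetric x u + dmetric x v.
Proof. by move=> Ux a u v; apply: derive_dirP; exact: dg. Qed.

Lemma derive_ip x u v w : U x ->
  'D_u (fun y => ip (g y) v w) x = ip (dmetric x u) v w.
Proof.
move=> Ux; have dx := dg Ux.
have dgv : differentiable (fun y => v *m g y) x.
  exact: (@differentiable_mulmx _ _ _ _ _ (fun=> v)).
have dgvw : differentiable (fun y => v *m g y *m w^T) x.
  exact: (@differentiable_mulmx _ _ _ _ _ _ (fun=> w^T)).
rewrite /ip -(derive_mx_coord _ _ _ dgvw).
by rewrite (derive_mulmxl _ _ dgv) (derive_mulmxr _ _ dx).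
Qed.

Definition conn x : 'rV[R]_d -> 'M[R]_d := koszul_mx (g x) (dmetric x).

Lemma christoffelE x u v : U x -> christoffel g x u v = v *m conn x u.
Proof.
move=> Ux; rewrite /conn -koszul_vectorE; last exact: dmetric_lin.
  congr (_ *m _); apply/rowP => k; rewrite !mxE /koszul /koszul_form.
  by rewrite (derive_ip u v (delta_mx 0 k) Ux) (derive_ip v u (delta_mx 0 k) Ux)
             (derive_ip (delta_mx 0 k) u v Ux).
exact: gpos.
Qed.

Lemma conn_smooth u : smooth U (conn ^~ u).
Proof.
have sD v : smooth U (dmetric ^~ v) by exact: smooth_derive.
have sk a b c : smooth U (fun x => koszul_form (dmetric x) a b c).
  apply: smoothM => //; first exact: smooth_cst.
  apply: smoothB => //; first apply: smoothD => //;
  by apply: smooth_ip => //; exact: smooth_cst.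
have sv i : smooth U (fun x => koszul_vector (g x) (dmetric x) u (delta_mx 0 i)).
  apply: smooth_mulmx => //; last first.
    by apply: smooth_invmx => // x Ux; apply: posdef_unit; exact: gpos.
  by apply/(smooth_mxP oU) => l k; under eq_fun do rewrite mxE; exact: sk.
apply/(smooth_mxP oU) => i j; under eq_fun do rewrite mxE.
by move: (sv i) => /(smooth_mxP oU); exact.
Qed.

Let dconn_diff u x : U x -> differentiable (conn ^~ u) x.
Proof. exact: smooth_differentiable (conn_smooth u). Qed.

Lemma connC x : U x -> forall u v, u *m conn x v = v *m conn x u.
Proof.
move=> Ux u v; apply: koszul_mxC; [exact: gpos|by move=> w; exact: dmetricT|].
exact: dmetric_lin.
Qed.

Lemma conn_lin x : U x ->
  forall a u v, conn x (a *: u + v) = a *: conn x u + conn x v.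
Proof.
move=> Ux a u v; apply: koszul_mx_lin; [exact: gpos|by move=> w; exact: dmetricT|].
exact: dmetric_lin.
Qed.

Lemma conn_metric x : U x ->
  forall u, dmetric x u = conn x u *m g x + g x *m (conn x u)^T.
Proof.
move=> Ux u; apply: koszul_mx_metric; [exact: gpos|by move=> w; exact: dmetricT| |].
  exact: dmetric_lin.
exact: gT.
Qed.

Definition dconn x u v : 'M[R]_d := 'D_u (conn ^~ v) x.

Definition ddconn x w u v : 'M[R]_d := 'D_w (fun y => dconn y u v) x.

Definition riem x : 'rV[R]_d -> 'rV[R]_d -> 'M[R]_d := curv_mx (conn x) (dconn x).

Lemma dconn_smooth u v : smooth U (fun x => dconn x u v).
Proof. by apply: smooth_derive; exact: conn_smooth. Qed.

Lemma dconnC x : U x -> forall z u v, u *m dconn x z v = v *m dconn x z u.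
Proof.
move=> Ux z u v; rewrite /dconn.
rewrite -(derive_mulmxr u z (dconn_diff v Ux)) -(derive_mulmxr v z (dconn_diff u Ux)).
by apply: (@derive_ext _ _ _ oU) Ux => y Uy; exact: connC.
Qed.

Lemma dconn_linl x : U x -> forall a u v w,
  dconn x (a *: u + v) w = a *: dconn x u w + dconn x v w.
Proof. by move=> Ux a u v w; apply: derive_dirP; exact: dconn_diff. Qed.

Lemma dconn_linr x : U x -> forall a u v w,
  dconn x w (a *: u + v) = a *: dconn x w u + dconn x w v.
Proof.
move=> Ux a u v w; rewrite /dconn.
rewrite -(derive_lin a w (dconn_diff u Ux) (dconn_diff v Ux)).
by apply: (@derive_ext _ _ _ oU) Ux => y Uy; exact: conn_lin.
Qed.

Lemma ddconnC x : U x -> forall w u v, ddconn x w u v = ddconn x u w v.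
Proof.
move=> Ux w u v.
exact: (derive_comm w u oU (conn_smooth v) Ux).
Qed.

Lemma derive_dmetric x u v : U x -> 'D_u (dmetric ^~ v) x =
  dconn x u v *m g x + conn x v *m dmetric x u
  + dmetric x u *m (conn x v)^T + g x *m (dconn x u v)^T.
Proof.
move=> Ux; have dv := dconn_diff v Ux; have dx := dg Ux.
have dvT := differentiable_trmx dv.
transitivity ('D_u (fun y => 1 *: (conn y v *m g y) + g y *m (conn y v)^T) x).
  apply: (@derive_ext _ _ _ oU) Ux => y Uy.
  by rewrite scale1r; exact: conn_metric.
rewrite (derive_lin 1 u (differentiable_mulmx dv dx) (differentiable_mulmx dx dvT)).
by rewrite scale1r (derive_mulmx u dv dx) (derive_mulmx u dx dvT) (derive_trmx u dv) !addrA.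
Qed.

Lemma riem_skew x u v : U x -> riem x u v *m g x = - (g x *m (riem x u v)^T).
Proof.
move=> Ux; apply: (curv_mx_skew (conn_metric Ux)).
rewrite -(derive_dmetric u v Ux) -(derive_dmetric v u Ux).
exact: (derive_comm u v oU sg Ux).
Qed.

Lemma curvE x u v w z : U x -> curv g x u v w z = ip (g x) (w *m riem x u v) z.
Proof.
move=> Ux; rewrite /curv; congr (ip _ _ _).
have nablaE a b y : U y -> nabla g (cst a) (cst b) y = b *m conn y a.
  by move=> Uy; rewrite /nabla derive_cst add0r christoffelE.
have nabla2E a b : nabla g (cst a) (nabla g (cst b) (cst w)) x =
    w *m dconn x a b + w *m conn x b *m conn x a.
  rewrite /nabla [in LHS]/cst /= -/(nabla g (cst b) (cst w)).
  congr (_ + _).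
    rewrite -(derive_mulmxr w a (dconn_diff b Ux)).
    by apply: (@derive_ext _ _ _ oU) Ux => y Uy; exact: nablaE.
  by rewrite (christoffelE _ _ Ux) -/(nabla g (cst b) (cst w) x) nablaE.
rewrite /curvature_op !nabla2E.
have -> : nabla g (lie_bracket (cst u) (cst v)) (cst w) x = 0.
  have L0 : lie_bracket (cst u) (cst v) x = 0.
    by rewrite /lie_bracket !derive_cst subrr.
  by rewrite /nabla L0 derive0 add0r (christoffelE _ _ Ux) (connC Ux) mul0mx.
rewrite subr0 /riem /curv_mx.
by move: (dconn x u v) (dconn x v u) (conn x u) (conn x v) => ? ? ? ?; mx_ring.
Qed.

Lemma derive_riem x w u v : U x -> 'D_w (fun y => riem y u v) x =
  ddconn x w u v - ddconn x w v u
  + (dconn x w v *m conn x u + conn x v *m dconn x w u)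
  - (dconn x w u *m conn x v + conn x u *m dconn x w v).
Proof.
move=> Ux; have du := dconn_diff u Ux; have dv := dconn_diff v Ux.
have duv := smooth_differentiable (dconn_smooth u v) Ux.
have dvu := smooth_differentiable (dconn_smooth v u) Ux.
have dAvu := differentiable_mulmx dv du; have dAuv := differentiable_mulmx du dv.
have dsum1 : differentiable (fun y => -1 *: dconn y v u + dconn y u v) x.
  exact: (differentiable_lin _ dvu duv).
have dsum2 : differentiable (fun y => 1 *: (conn y v *m conn y u) +
    (-1 *: dconn y v u + dconn y u v)) x.
  exact: (differentiable_lin _ dAvu dsum1).
transitivity ('D_w (fun y => -1 *: (conn y u *m conn y v) +
    (1 *: (conn y v *m conn y u) + (-1 *: dconn y v u + dconn y u v))) x).
  apply: (@derive_ext _ _ _ oU) Ux => y Uy.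
  rewrite /riem /curv_mx.
  by move: (dconn y u v) (dconn y v u) (conn y u) (conn y v) => ? ? ? ?; mx_ring.
have E1 : 'D_w (fun y => conn y u *m conn y v) x =
    dconn x w u *m conn x v + conn x u *m dconn x w v := derive_mulmx w du dv.
have E2 : 'D_w (fun y => conn y v *m conn y u) x =
    dconn x w v *m conn x u + conn x v *m dconn x w u := derive_mulmx w dv du.
have E3 : 'D_w (fun y => -1 *: dconn y v u + dconn y u v) x =
    -1 *: ddconn x w v u + ddconn x w u v := derive_lin _ w dvu duv.
rewrite (derive_lin _ w dAuv dsum2) E1 (derive_lin _ w dAvu dsum1) E2 E3 {E1 E2 E3}.
move: (ddconn x w u v) (ddconn x w v u) (dconn x w u) (dconn x w v) => ? ? ? ?.
by move: (conn x u) (conn x v) => ? ?; mx_ring.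
Qed.

Lemma riem_smooth u v : smooth U (fun x => riem x u v).
Proof.
have sB (f h : 'rV[R]_d -> 'M[R]_d) :
    smooth U f -> smooth U h -> smooth U (fun x => f x - h x).
  move=> /(smooth_mxP oU) sf /(smooth_mxP oU) sh; apply/(smooth_mxP oU) => i j.
  by under eq_fun do rewrite mxDE mxNE; apply: smoothB.
have sA := conn_smooth; have sdA := dconn_smooth.
by apply: (sB); [apply: smoothD => //; [exact: sB|]|]; exact: smooth_mulmx.
Qed.

(** Schur's lemma. Differentiating R = a S, where S is the curvature of constant
    curvature 1, the second Bianchi identity leaves the cyclic sum of da(w) S(u, v);
    evaluated on an orthogonal triple it gives da = 0. *)
Lemma schur (a : 'rV[R]_d -> R) x w : (2 < d)%N ->
  smooth U a -> (forall y, U y -> forall u v, riem y u v = a y *: wedge_mx (g y) u v) ->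
  U x -> 'D_w a x = 0.
Proof.
move=> d3 sa Ra Ux.
have da := smooth_differentiable sa Ux; have dx := dg Ux.
pose E u v : 'M[R]_d := v^T *m u - u^T *m v.
have dR b u v : 'D_b (fun y => riem y u v) x =
    'D_b a x *: wedge_mx (g x) u v + a x *: (dmetric x b *m E u v).
  have dE : differentiable (fun y => g y *m E u v) x.
    exact: (@differentiable_mulmx _ _ _ _ _ _ (fun=> E u v)).
  transitivity ('D_b (fun y => a y *: (g y *m E u v)) x).
    by apply: (@derive_ext _ _ _ oU) Ux => y Uy; exact: Ra.
  by rewrite (derive_scalemx b da dE) (derive_mulmxl (E u v) b dx).
have cyc u v b : 'D_b a x *: wedge_mx (g x) u v + 'D_u a x *: wedge_mx (g x) v b
    + 'D_v a x *: wedge_mx (g x) b u = 0.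
  have B2 := bianchi2 u v b (ddconnC Ux) (fun b u v => derive_riem b u v Ux).
  have BS := bianchi2_wedge u v b (connC Ux) (conn_metric Ux).
  rewrite /= -/(riem x u v) -/(riem x v b) -/(riem x b u) !dR !(Ra x Ux) in B2.
  exact: cyclic_leibniz B2 BS.
have [u u0 uw] : exists2 u, u != 0 & forall v, v \in [:: w] -> ip (g x) u v = 0.
  by apply: exists_orthogonal; exact: leq_ltn_trans d3.
have [v v0 vuw] := exists_orthogonal (g x) (d3 : (size [:: u; w] < d)%N).
have {}uw : ip (g x) u w = 0 by apply: uw; rewrite !inE eqxx.
have vu : ip (g x) v u = 0 by apply: vuw; rewrite !inE eqxx.
have vw : ip (g x) v w = 0 by apply: vuw; rewrite !inE eqxx orbT.
have /(congr1 (fun M => ip (g x) (v *m M) u)) := cyc u v w.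
rewrite mulmx0 ip0l !mulmxDr -!scalemxAr !wedge_mxE vu vw !scale0r.
rewrite ?subr0 ?sub0r ?scaler0 ?addr0 ipDl !ipZl ipNl ipZl (ipC w u (gT Ux)) uw.
rewrite !(mulr0, oppr0, addr0) => /eqP; rewrite !mulf_eq0.
by rewrite (gt_eqF (gpos Ux u0)) (gt_eqF (gpos Ux v0)) !orbF => /eqP.
Qed.

End levi_civita.

(** * Algebraic curvature tensors *)

Section curvature_tensors.
Variables (R : rcfType) (V : lmodType R).
Implicit Types (x y z w X Y Z U : V) (T : V -> V -> V -> V -> R).

(** The algebraic symmetries of a curvature tensor; linearity in the other three
    arguments and the symmetry in pairs follow. *)
Definition curvature_like T : Prop :=
  [/\ forall a x y z w t, T (a *: x + y) z w t = a * T x z w t + T y z w t,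
      forall x y z w, T x y z w = - T y x z w,
      forall x y z w, T x y z w = - T x y w z &
      forall x y z w, T x y z w + T y z x w + T z x y w = 0].

Section symmetries.
Variable T : V -> V -> V -> V -> R.
Hypothesis cT : curvature_like T.

Let Tl a x y z w t : T (a *: x + y) z w t = a * T x z w t + T y z w t.
Proof. by case: cT. Qed.

Lemma curv_anti12 x y z w : T x y z w = - T y x z w.
Proof. by case: cT. Qed.

Lemma curv_anti34 x y z w : T x y z w = - T x y w z.
Proof. by case: cT. Qed.

Lemma curv_bianchi x y z w : T x y z w + T y z x w + T z x y w = 0.
Proof. by case: cT. Qed.

Lemma curv_pairC x y z w : T x y z w = T z w x y.
Proof.
have := curv_bianchi x y z w; have := curv_bianchi y z w x.
have := curv_bianchi z w x y; have := curv_bianchi w x y z.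
rewrite (curv_anti34 x y w z) (curv_anti34 z w y x) (curv_anti34 y z w x).
rewrite (curv_anti12 x z w y) (curv_anti34 z x w y) (curv_anti12 y w x z).
rewrite (curv_anti34 w y x z) (curv_anti34 w x z y); lra.
Qed.

Lemma curvD1 x y z w t : T (x + y) z w t = T x z w t + T y z w t.
Proof. by rewrite -[x in LHS]scale1r Tl mul1r. Qed.

Lemma curvZ1 a x z w t : T (a *: x) z w t = a * T x z w t.
Proof.
have T0 : T 0 z w t = 0 by have := Tl (-1) 0 0 z w t; rewrite scaler0 addr0; lra.
by rewrite -[a *: x]addr0 Tl T0 addr0.
Qed.

Lemma curvD2 x y z w t : T z (x + y) w t = T z x w t + T z y w t.
Proof. by rewrite (curv_anti12 z) curvD1 !(curv_anti12 z) opprD. Qed.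

Lemma curvZ2 a x z w t : T z (a *: x) w t = a * T z x w t.
Proof. by rewrite (curv_anti12 z) curvZ1 (curv_anti12 z) mulrN. Qed.

Lemma curvD3 x y z w t : T z w (x + y) t = T z w x t + T z w y t.
Proof. by rewrite curv_pairC curvD1 !(curv_pairC z). Qed.

Lemma curvZ3 a x z w t : T z w (a *: x) t = a * T z w x t.
Proof. by rewrite curv_pairC curvZ1 !(curv_pairC z). Qed.

Lemma curvD4 x y z w t : T z w t (x + y) = T z w t x + T z w t y.
Proof. by rewrite curv_pairC curvD2 !(curv_pairC z). Qed.

Lemma curvZ4 a x z w t : T z w t (a *: x) = a * T z w t x.
Proof. by rewrite curv_pairC curvZ2 !(curv_pairC z). Qed.

Lemma curvN1 x z w t : T (- x) z w t = - T x z w t.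
Proof. by rewrite -scaleN1r curvZ1 mulN1r. Qed.

Lemma curvN2 x z w t : T z (- x) w t = - T z x w t.
Proof. by rewrite -scaleN1r curvZ2 mulN1r. Qed.

Lemma curvN3 x z w t : T z w (- x) t = - T z w x t.
Proof. by rewrite -scaleN1r curvZ3 mulN1r. Qed.

Lemma curvN4 x z w t : T z w t (- x) = - T z w t x.
Proof. by rewrite -scaleN1r curvZ4 mulN1r. Qed.

Lemma curv01 z w t : T 0 z w t = 0.
Proof. by have := curvZ1 0 0 z w t; rewrite scale0r mul0r. Qed.

Lemma curv02 z w t : T z 0 w t = 0.
Proof. by have := curvZ2 0 0 z w t; rewrite scale0r mul0r. Qed.

Lemma curv03 z w t : T z w 0 t = 0.
Proof. by have := curvZ3 0 0 z w t; rewrite scale0r mul0r. Qed.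

Lemma curv04 z w t : T z w t 0 = 0.
Proof. by have := curvZ4 0 0 z w t; rewrite scale0r mul0r. Qed.

Definition curv_linE := (curvD1, curvD2, curvD3, curvD4, curvZ1, curvZ2, curvZ3,
  curvZ4, (curvN1, curvN2, curvN3, curvN4)).

Lemma curvxx x z w : T x x z w = 0.
Proof. by have := curv_anti12 x x z w; lra. Qed.

Lemma curvyy x z w : T z w x x = 0.
Proof. by rewrite curv_pairC curvxx. Qed.

(** By polarization T is alternating in its first three arguments, so the Bianchi
    identity reads 3 T = 0. *)
Lemma curv_eq0 : (forall x y, T x y y x = 0) -> forall x y z w, T x y z w = 0.
Proof.
move=> K.
have K2 x y w : T x y y w = 0.
  have := K (x + w) y; rewrite !curv_linE !K (curv_pairC w y y x).
  by rewrite (curv_anti12 y x) (curv_anti34 x y w); lra.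
have K3 x y z w : T x y z w = - T x z y w.
  by have := K2 x (y + z) w; rewrite !curv_linE !K2; lra.
move=> x y z w; have := curv_bianchi x y z w.
rewrite (K3 y z x w) (curv_anti12 y x) (curv_anti12 z x) (K3 x z y w).
by lra.
Qed.

End symmetries.

Lemma curvature_like_sub T S a : curvature_like T -> curvature_like S ->
  curvature_like (fun x y z w => T x y z w - a * S x y z w).
Proof.
move=> [lT aT bT cT] [lS aS bS cS]; split.
- by move=> b x y z w t; rewrite lT lS; ring.
- by move=> x y z w; rewrite (aT x y) (aS x y); ring.
- by move=> x y z w; rewrite (bT x y z w) (bS x y z w); ring.
move=> x y z w; have cTx := cT x y z w; have cSx := cS x y z w.
transitivity ((T x y z w + T y z x w + T z x y w)
  - a * (S x y z w + S y z x w + S z x y w)); first by ring.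
by rewrite cTx cSx; ring.
Qed.

End curvature_tensors.

(** * Curvature tensors on a Hermitian vector space *)
Section hermitian.
Variables (R : rcfType) (V : lmodType R) (g : V -> V -> R) (J : V -> V).
Implicit Types (x y z w X Y Z U : V) (T : V -> V -> V -> V -> R).
Hypotheses (g_lin : forall a x y z, g (a *: x + y) z = a * g x z + g y z)
  (gC : forall x y, g x y = g y x) (g_gt0 : forall x, x != 0 -> 0 < g x x).
Hypotheses (JD : forall x y, J (x + y) = J x + J y) (JK : forall x, J (J x) = - x)
  (Jg : forall x y, g (J x) (J y) = g x y).
(* This is where the complex dimension has to be at least 3. *)
Hypothesis complex_dim_ge3 : forall x y, exists2 z, z != 0 &
  [/\ g z x = 0, g z (J x) = 0, g z y = 0 & g z (J y) = 0].

Let gDl x y z : g (x + y) z = g x z + g y z.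
Proof. by rewrite -[x in LHS]scale1r g_lin mul1r. Qed.

Let gZl a x z : g (a *: x) z = a * g x z.
Proof.
have g0 : g 0 z = 0 by have := g_lin (-1) 0 0 z; rewrite scaler0 addr0; lra.
by rewrite -[a *: x]addr0 g_lin g0 addr0.
Qed.

Let gDr x y z : g z (x + y) = g z x + g z y.
Proof. by rewrite gC gDl !(gC z). Qed.

Let gZr a x z : g z (a *: x) = a * g z x.
Proof. by rewrite gC gZl !(gC z). Qed.

Let gNl x z : g (- x) z = - g x z.
Proof. by rewrite -scaleN1r gZl mulN1r. Qed.

Let gNr x z : g z (- x) = - g z x.
Proof. by rewrite -scaleN1r gZr mulN1r. Qed.

Let g_linE := (gDl, gDr, gZl, gZr, gNl, gNr).

Let gJl x y : g (J x) y = - g x (J y).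
Proof. by rewrite -Jg JK gNl. Qed.

Let gxJx x : g x (J x) = 0.
Proof. by have := gJl x x; rewrite gC; lra. Qed.

Let JN x : J (- x) = - J x.
Proof. by rewrite -JK JK. Qed.

(** The curvature tensor of constant curvature 1. *)
Definition unit_curv x y z w : R := g y z * g x w - g x z * g y w.

Lemma unit_curv_like : curvature_like unit_curv.
Proof.
split; rewrite /unit_curv.
- by move=> a x y z w t; rewrite !g_linE; ring.
- by move=> x y z w; ring.
- by move=> x y z w; ring.
- by move=> x y z w; rewrite (gC z x) (gC z y) (gC y x); ring.
Qed.

(** Orthogonality for the Hermitian form whose real part is g; for nonzero vectors
    it means that X and Y span an antiholomorphic plane and are orthogonal. *)
Definition cperp Y X : Prop := g Y X = 0 /\ g Y (J X) = 0.

Lemma cperp_sym X Y : cperp Y X -> cperp X Y.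
Proof. by move=> [YX YJX]; split; rewrite gC// gJl YJX oppr0. Qed.

Lemma cperpJ X Y : cperp Y X -> cperp Y (J X).
Proof. by move=> [YX YJX]; split=> //; rewrite JK gNr YX oppr0. Qed.

(** What the umbilical submanifolds tangent to a plane containing Y, J Y and X,
    and orthogonal to U, say about the curvature. *)
Definition coholomorphic_codazzi T : Prop := forall Y X U,
  cperp Y X -> cperp Y U -> g X U = 0 ->
  T Y (J Y) X U = 0 /\ T X Y (J Y) U = 0.

Section vanishing.
Variable T : V -> V -> V -> V -> R.
Hypotheses (cT : curvature_like T) (TA : coholomorphic_codazzi T).
Hypothesis TK : forall X Y, cperp X Y -> T X Y Y X = 0.

Lemma codazzi3 Y X U : cperp Y X -> cperp Y U -> g X U = 0 ->
  [/\ T Y (J Y) X U = 0, T X Y (J Y) U = 0 & T X (J Y) Y U = 0].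
Proof.
move=> YX YU XU; have [H1 H2] := TA YX YU XU; split=> //.
have := curv_bianchi cT Y (J Y) X U.
by rewrite H1 H2 (curv_anti12 cT (J Y) X); lra.
Qed.

(** Polarization of the vanishing on antiholomorphic planes. *)
Lemma cperp_polar X Y Z : cperp X Y -> cperp Z Y -> T X Y Y Z = 0.
Proof.
move=> XY ZY; have XZY : cperp (X + Z) Y.
  by case: XY => XY XJY; case: ZY => ZY ZJY; split; rewrite g_linE ?XY ?ZY ?XJY ?ZJY addr0.
have := TK XZY; rewrite !(curv_linE cT) (TK XY) (TK ZY) (curv_pairC cT Z).
by rewrite (curv_anti12 cT Y X) (curv_anti34 cT X Y Z); lra.
Qed.

Lemma scale_norm X Y : Y != 0 -> exists a, g (a *: Y) (a *: Y) = g X X.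
Proof.
move=> Y0; have gY := g_gt0 Y0.
have gX : 0 <= g X X.
  by have [->|/g_gt0/ltW//] := eqVneq X 0; rewrite -[X in g X _](scale0r (0 : V)) gZl mul0r.
exists (Num.sqrt (g X X / g Y Y)).
rewrite gZl gZr mulrA -expr2 sqr_sqrtr ?divr_ge0 ?(ltW gY)// divfK//.
by rewrite gt_eqF.
Qed.

Lemma exists_cperp_norm X Z : exists Y,
  [/\ g Y Y = g X X, cperp Y X & cperp Y Z].
Proof.
have [Y Y0 [YX YJX YZ YJZ]] := complex_dim_ge3 X Z.
have [a aY] := scale_norm X Y0; exists (a *: Y).
by split=> //; split; rewrite gZl ?YX ?YJX ?YZ ?YJZ mulr0.
Qed.

(** X + Y and J X - J Y, as well as X - Y and J X + J Y, span antiholomorphic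
    planes. In the sum of the two corresponding equations the terms that are odd in
    Y disappear, and the terms on orthogonal quadruples vanish by hypothesis. *)
Lemma holo_sum X Y : g Y Y = g X X -> cperp Y X ->
  T X (J X) (J X) X + T Y (J Y) (J Y) Y = 0.
Proof.
move=> YY YX; have XY := cperp_sym YX.
have [yx yjx] := YX; have [xy xjy] := XY.
have P1 : cperp (X + Y) (J X - J Y).
  split; rewrite ?JD ?JN ?JK !g_linE ?gxJx ?(gC Y X) ?xjy ?yjx ?xy ?YY; lra.
have P2 : cperp (X - Y) (J X + J Y).
  split; rewrite ?JD ?JN ?JK !g_linE ?gxJx ?(gC Y X) ?xjy ?yjx ?xy ?YY; lra.
have := TK P1; have := TK P2; rewrite !(curv_linE cT).
have H1 : T X (J Y) (J Y) X = 0 by apply: TK; exact: cperpJ.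
have H2 : T Y (J X) (J X) Y = 0 by apply: TK; exact: cperpJ.
have JYY : g (J Y) Y = 0 by rewrite gC gxJx.
have JXX : g (J X) X = 0 by rewrite gC gxJx.
have [H3 _ H4] := codazzi3 (cperpJ XY) XY JYY.
have [H5 _ H6] := codazzi3 (cperpJ YX) YX JXX.
have H7 : T X (J Y) (J X) Y = 0.
  have [_ + _] := codazzi3 (cperpJ XY) XY JYY; rewrite (curv_anti12 cT); lra.
have H8 : T Y (J X) (J Y) X = 0.
  have [_ + _] := codazzi3 (cperpJ YX) YX JXX; rewrite (curv_anti12 cT); lra.
by lra.
Qed.

(** Applied to the pairs among three vectors, the previous lemma gives three
    equations whose only solution is 0. *)
Lemma holo_eq0 X : T X (J X) (J X) X = 0.
Proof.
have [Y [YY YX _]] := exists_cperp_norm X X.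
have [Z [ZZ ZX ZY]] := exists_cperp_norm X Y.
have := holo_sum YY YX; have := holo_sum ZZ ZX.
have := holo_sum (etrans ZZ (esym YY)) ZY; lra.
Qed.

(** The same test planes as for the holomorphic curvatures, polarized in the
    direction of Z. *)
Lemma mixed_eq0 X Z : cperp Z X -> T (J X) X X Z = 0.
Proof.
move=> ZX; have [Y [YY YX YZ]] := exists_cperp_norm X Z.
have XY := cperp_sym YX; have ZY := cperp_sym YZ.
have [yx yjx] := YX; have [xy xjy] := XY; have [zx zjx] := ZX; have [zy zjy] := ZY.
have P1 : cperp (J X - J Y) (X + Y).
  split; rewrite ?JD !g_linE ?Jg ?gJl ?gxJx ?(gC Y X) ?xjy ?yjx ?xy ?YY; lra.
have P2 : cperp (J X + J Y) (X - Y).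
  split; rewrite ?JD ?JN !g_linE ?Jg ?gJl ?gxJx ?(gC Y X) ?xjy ?yjx ?xy ?YY; lra.
have Q1 : cperp Z (X + Y) by split; rewrite ?JD g_linE ?zx ?zy ?zjx ?zjy addr0.
have Q2 : cperp Z (X - Y) by split; rewrite ?JD ?JN !g_linE ?zx ?zy ?zjx ?zjy subrr.
have := cperp_polar P1 Q1; have := cperp_polar P2 Q2; rewrite !(curv_linE cT).
have H1 : T (J X) Y Y Z = 0.
  by apply: cperp_polar => //; apply: cperp_sym; exact: cperpJ.
have [H2 _ H3] := codazzi3 YX YZ (etrans (gC X Z) zx).
have H2' : T (J Y) Y X Z = 0 by rewrite (curv_anti12 cT) H2 oppr0.
have H3' : T (J Y) X Y Z = 0 by rewrite (curv_anti12 cT) H3 oppr0.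
by rewrite H1 H2' H3'; lra.
Qed.

(** Every plane is spanned by X and some b J X + W with W in the Hermitian
    complement of X; the holomorphic, mixed and antiholomorphic parts all vanish. *)
Lemma codazzi_eq0 X Y Z U : T X Y Z U = 0.
Proof.
apply: (curv_eq0 cT) => {}X {}Y.
have [->|X0] := eqVneq X 0; first by rewrite (curv01 cT).
have X1 := g_gt0 X0; have X1' : g X X != 0 by rewrite gt_eqF.
pose a := g Y X / g X X; pose b := g Y (J X) / g X X.
pose W := Y - a *: X - b *: J X.
have WX : cperp W X.
  split; rewrite /W !g_linE ?Jg ?gxJx ?(gC (J X) X) ?gxJx /a /b; by field.
have -> : Y = W + b *: J X + a *: X by rewrite /W !subrK.
clearbody W => {X1'}.
have M := mixed_eq0 WX.
have M1 : T X W (J X) X = 0.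
  by rewrite (curv_pairC cT) (curv_anti34 cT) (curv_anti12 cT) opprK (curv_pairC cT)
    (curv_anti12 cT) (curv_anti34 cT) opprK (curv_pairC cT) -[RHS]M.
have M2 : T X (J X) W X = 0.
  by rewrite (curv_anti12 cT) (curv_anti34 cT) opprK.
rewrite !(curv_linE cT) !(curvxx cT) !(curvyy cT) (TK (cperp_sym WX)) holo_eq0 M1 M2.
by ring.
Qed.

End vanishing.

(** Subtracting alpha times the curvature of constant curvature 1 reduces to the
    case of vanishing antiholomorphic sectional curvature. *)
Lemma constant_curvature_of_codazzi T alpha :
  curvature_like T -> coholomorphic_codazzi T ->
  (forall X Y, cperp X Y -> T X Y Y X - T X Y (J Y) (J X) = alpha * (g X X * g Y Y)) ->
  forall x y z w, T x y z w = alpha * unit_curv x y z w.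
Proof.
move=> cT TA TL x y z w; apply/eqP; rewrite -subr_eq0; apply/eqP.
apply: (@codazzi_eq0 (fun x y z w => T x y z w - alpha * unit_curv x y z w)).
- exact: curvature_like_sub unit_curv_like.
- move=> Y X U YX YU XU; have [H1 H2] := TA _ _ _ YX YU XU.
  rewrite H1 H2 /unit_curv; have [yx yjx] := YX; have [yu yju] := YU.
  by rewrite XU yx yu !gJl yjx yju; split; ring.
move=> X Y XY; have [xy xjy] := XY.
have YX := cperp_sym XY.
have [_ H] := TA _ _ _ YX (cperpJ YX) (gxJx X).
have := TL _ _ XY; rewrite H /unit_curv xy; lra.
Qed.

End hermitian.

(** * Coholomorphic planes *)

Section stable_subspaces.
Variables (R : realType) (d : nat) (J : 'M[R]_d).
Hypothesis JJ : J *m J = - 1%:M.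
Implicit Types (u v w : 'rV[R]_d).

Lemma mulmx_JJ p (A : 'M[R]_(p, d)) : A *m J *m J = - A.
Proof. by rewrite -mulmxA JJ mulmxN mulmx1. Qed.

Lemma rank_add_row p (W : 'M[R]_(p, d)) v : ~~ (v <= W)%MS -> \rank (W + v)%MS = (\rank W).+1.
Proof.
move=> vW; apply/eqP; rewrite eqn_leq; apply/andP; split.
  apply: leq_trans (mxrank_adds_leqif _ _) _.
  by rewrite -[(\rank W).+1]addn1 leq_add2l rank_leq_row.
apply: rank_ltmx; rewrite ltmxE addsmxSl /=.
by apply: contra vW => /(submx_trans _); apply; exact: addsmxSr.
Qed.

(** Were v J = w + c v with w in W, applying J once more would put (1 + c^2) v in
    W. *)
Lemma stable_add_line (W : 'M[R]_d) v : (W *m J <= W)%MS -> ~~ (v <= W)%MS ->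
  ((W + v + v *m J)%MS *m J <= W + v + v *m J)%MS /\
  \rank (W + v + v *m J)%MS = (\rank W).+2.
Proof.
move=> WJ vW; split.
  rewrite addsmxMr addsmx_sub addsmxMr addsmx_sub -andbA; apply/and3P; split.
  - exact: submx_trans WJ (submx_trans (addsmxSl _ _) (addsmxSl _ _)).
  - exact: addsmxSr.
  - by rewrite mulmx_JJ eqmx_opp; exact: submx_trans (addsmxSr _ _) (addsmxSl _ _).
rewrite rank_add_row ?rank_add_row//; apply/negP => /sub_addsmxP[[a c] /= vJ].
have c11 : c = (c 0 0)%:M by exact: mx11_scalar.
have : (1 + c 0 0 ^+ 2) *: v = - (a *m W *m J) - c 0 0 *: (a *m W).
  have := congr1 (mulmx^~ J) vJ; rewrite mulmx_JJ mulmxDl -(mulmxA c) vJ c11 mul_scalar_mx.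
  rewrite mul_scalar_mx scalerDr scalerA -expr2 mxE /= mulr1n scalerDl scale1r => E.
  by rewrite -[X in X + _]opprK E !opprD addrA subrK.
move=> /(congr1 (fun x => (1 + c 0 0 ^+ 2)^-1 *: x)).
rewrite scalerK; last by rewrite gt_eqF// ltr_pwDl// sqr_ge0.
move=> E; case/negP: vW; rewrite E scalemx_sub// addmx_sub// eqmx_opp.
  by rewrite (submx_trans _ WJ)// submxMr// submxMl.
by rewrite scalemx_sub// submxMl.
Qed.

(** Complex lines are added to S one at a time. *)
Lemma stable_between a n (S B : 'M[R]_d) : (S *m J <= S)%MS -> (B *m J <= B)%MS ->
  (S <= B)%MS -> \rank S = (2 * a)%N -> (a <= n)%N -> (2 * n <= \rank B)%N ->
  exists W : 'M[R]_d,
    [/\ (W *m J <= W)%MS, (S <= W)%MS, (W <= B)%MS & \rank W = (2 * n)%N].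
Proof.
move=> SJ BJ SB rS /subnK <-; elim: (n - a)%N => [|k IH] rB; first by exists S.
have [|W [WJ SW WB rW]] := IH; first by apply: leq_trans rB; lia.
have /row_subPn[i vW] : ~~ (B <= W)%MS.
  by apply/negP => /mxrankS; rewrite rW; lia.
have [WvJ rWv] := stable_add_line WJ vW.
have vB : (row i B <= B)%MS by exact: row_sub.
exists (W + row i B + row i B *m J)%MS; split=> //.
- exact: submx_trans SW (submx_trans (addsmxSl _ _) (addsmxSl _ _)).
- by rewrite !addsmx_sub WB vB (submx_trans _ BJ)// submxMr.
by rewrite rWv rW; lia.
Qed.

Lemma exists_row_free k (W : 'M[R]_d) : \rank W = k ->
  exists2 B : 'M[R]_(k, d), row_free B & (B :=: W)%MS.
Proof. by move=> <-; exists (row_base W); [exact: row_base_free|exact: eq_row_base]. Qed.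

Lemma coholomorphic_of_spaces n (W A : 'M[R]_d) :
  (W *m J <= W)%MS -> \rank W = (2 * n)%N -> (W <= A)%MS -> \rank A = (2 * n).+1 ->
  exists2 P : 'M[R]_((2 * n).+1, d), coholomorphic_plane J P & (P :=: A)%MS.
Proof.
move=> WJ rW WA rA.
have [P fP PA] := exists_row_free rA; have [B fB BW] := exists_row_free rW.
have BJ : (B *m J <= B)%MS by rewrite (eqmxMr J BW) BW.
exists P => //; split=> //; exists B; split; last by rewrite PA BW.
split=> //; rewrite /eqmx BJ /=.
by have := submxMr J BJ; rewrite mulmx_JJ eqmx_opp.
Qed.

End stable_subspaces.

Section coholomorphic_planes.
Variables (R : realType) (m n : nat) (G J : 'M[R]_(2 * m)).
Hypotheses (n_ge1 : (1 <= n)%N) (n_lt_m : (n < m)%N).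
Hypothesis JJ : J *m J = - 1%:M.
Hypothesis Gpos : forall u, u != 0 -> 0 < ip G u u.
Hypothesis GJ : forall u v, ip G (u *m J) (v *m J) = ip G u v.
Implicit Types (u v w X Y U : 'rV[R]_(2 * m)).

Lemma ipJl u v : ip G (u *m J) v = - ip G u (v *m J).
Proof. by rewrite -GJ (mulmx_JJ JJ) ipNl. Qed.

Lemma perp_mxJ s : (forall w, w \in s -> w *m J \in s \/ - (w *m J) \in s) ->
  (perp_mx G s *m J <= perp_mx G s)%MS.
Proof.
move=> sJ; apply/row_subP => i; rewrite row_mul; apply/perp_mxP => w ws.
have /perp_mxP P : (row i (perp_mx G s) <= perp_mx G s)%MS by exact: row_sub.
rewrite ipJl; have [/P ->|/P] := sJ w ws; first by rewrite oppr0.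
by rewrite ipNr.
Qed.

(** A coholomorphic plane spanned by Y, J Y, X and further complex lines, in the
    hyperplane orthogonal to U. When n = m - 1 this plane has to be the whole
    hyperplane; otherwise there is enough room for complex lines orthogonal to
    both X and U. *)
Lemma exists_coholomorphic X Y U : X != 0 -> Y != 0 -> U != 0 ->
  ip G Y X = 0 -> ip G Y (X *m J) = 0 -> ip G Y U = 0 -> ip G Y (U *m J) = 0 ->
  ip G X U = 0 ->
  exists A : 'M[R]_((2 * n).+1, 2 * m), coholomorphic_plane J A /\
    [/\ (Y <= A)%MS, (Y *m J <= A)%MS, (X <= A)%MS &
        forall v, (v <= A)%MS -> ip G v U = 0].
Proof.
move=> X0 Y0 U0 YX YJX YU YJU XU.
have rv (v : 'rV[R]_(2 * m)) : (v *m J) *m J = - v by exact: mulmx_JJ.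
have perpU p (A : 'M[R]_(p, 2 * m)) s : U \in s -> (A <= perp_mx G s)%MS ->
    forall v, (v <= A)%MS -> ip G v U = 0.
  by move=> Us As v vA; have /perp_mxP := submx_trans vA As; exact.
have YJU0 : ip G (Y *m J) U = 0 by rewrite ipJl YJU oppr0.
have [nm|mn] := ltnP n.+1 m; last first.
  have {}mn : (2 * m = (2 * n).+2)%N by lia.
  pose B := perp_mx G [:: U; U *m J].
  have BJ : (B *m J <= B)%MS.
    apply: perp_mxJ => w; rewrite !inE => /orP[]/eqP->.
      by left; rewrite eqxx orbT.
    by right; rewrite rv opprK eqxx.
  have rB : (2 * n <= \rank B)%N.
    by apply: leq_trans (rank_perp_mx _ _); rewrite /= mn; lia.
  have Z1 : ((0 : 'M[R]_(2 * m)) *m J <= (0 : 'M[R]_(2 * m)))%MS.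
    by rewrite mul0mx sub0mx.
  have [W [WJ _ WB rW]] :=
    stable_between JJ Z1 BJ (sub0mx _ _) (mxrank0 _ _ _ : _ = (2 * 0)%N) (leq0n n) rB.
  pose A := perp_mx G [:: U].
  have WA : (W <= A)%MS.
    apply: submx_trans WB _; apply/row_subP => i; apply/perp_mxP => w.
    rewrite !inE => /eqP->; apply: (perpU _ B [:: U; U *m J]) => //.
      by rewrite !inE eqxx.
    exact: row_sub.
  have rA : \rank A = (2 * n).+1.
    have := rank_perp_mx G [:: U]; rewrite -/A /= => rA.
    have : \rank A != (2 * m)%N.
      apply/negP => fA; have := perpU _ A [:: U] (mem_head _ _) (submx_refl _) U.
      by rewrite submx_full// => /(_ isT) UU; have := Gpos U0; rewrite UU ltxx.
    by have := rank_leq_row A; lia.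
  have [P cP PA] := coholomorphic_of_spaces JJ WJ rW WA rA.
  exists P; split=> //; split; rewrite ?PA.
  - by apply/perp_mxP => w; rewrite inE => /eqP->.
  - by apply/perp_mxP => w; rewrite inE => /eqP->.
  - by apply/perp_mxP => w; rewrite inE => /eqP->.
  by apply: (perpU _ P [:: U]); rewrite ?mem_head// PA.
pose B := perp_mx G [:: X; X *m J; U; U *m J].
have BJ : (B *m J <= B)%MS.
  apply: perp_mxJ => w; rewrite !inE => /or4P[]/eqP->.
  - by left; rewrite eqxx orbT.
  - by right; rewrite rv opprK eqxx.
  - by left; rewrite eqxx !orbT.
  - by right; rewrite rv opprK eqxx !orbT.
have rB : (2 * n <= \rank B)%N.
  by apply: leq_trans (rank_perp_mx _ _); rewrite /=; lia.
have YB : (Y <= B)%MS.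
  by apply/perp_mxP => w; rewrite !inE => /or4P[]/eqP->.
have [] := @stable_add_line _ _ J JJ 0 Y; rewrite ?mul0mx ?sub0mx ?submx0//.
rewrite mxrank0 => SJ rS; set S := (0 + Y + Y *m J)%MS in SJ rS.
have SB : (S <= B)%MS by rewrite !addsmx_sub sub0mx YB (submx_trans _ BJ)// submxMr.
have YS : (Y <= S)%MS by exact: submx_trans (addsmxSr _ _) (addsmxSl _ _).
have [W [WJ SW WB rW]] := stable_between JJ SJ BJ SB (rS : _ = (2 * 1)%N) n_ge1 rB.
pose A := (W + X)%MS.
have WU : forall v, (v <= W)%MS -> ip G v U = 0.
  by apply: perpU WB; rewrite !inE eqxx !orbT.
have rA : \rank A = (2 * n).+1.
  rewrite rank_add_row ?rW//; apply/negP => XW.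
  have /perp_mxP/(_ X (mem_head _ _)) XX := submx_trans XW WB.
  by have := Gpos X0; rewrite XX ltxx.
have [P cP PA] := coholomorphic_of_spaces JJ WJ rW (addsmxSl W X) rA.
exists P; split=> //; split; rewrite ?PA.
- exact: submx_trans YS (submx_trans SW (addsmxSl _ _)).
- exact: submx_trans (submxMr J YS) (submx_trans SJ (submx_trans SW (addsmxSl _ _))).
- exact: addsmxSr.
move=> v; rewrite PA => /sub_addsmxP[[a c] /= ->].
rewrite ipDl (WU (a *m W) (submxMl _ _)) (mx11_scalar c) mul_scalar_mx ipZl XU.
by rewrite mulr0 addr0.
Qed.

End coholomorphic_planes.

(** * The Gauss and Codazzi equations of an umbilical immersion *)

Section codazzi_algebra.
Variables (R : realType) (k d : nat).

(** The Codazzi equation as the antisymmetrization of the derivative of the Gauss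
    formula. The first two hypotheses are the Gauss formula in the directions u and
    v, the next two its derivatives; J is the differential of the immersion, B and C
    are the ambient and the intrinsic connection forms, G is the induced metric and
    h the mean curvature. The terms in h itself cancel because the induced metric is
    parallel and the intrinsic torsion vanishes. *)
Lemma codazzi_algebra (J DJu DJv DDJ : 'M[R]_(k, d)) (Bu Bv dBuv dBvu : 'M[R]_d)
    (Cu Cv dCuv dCvu G Gu Gv : 'M[R]_k) (u v : 'rV[R]_k) (h hu hv : 'rV[R]_d) :
  DJu + J *m Bu = Cu *m J + G *m u^T *m h ->
  DJv + J *m Bv = Cv *m J + G *m v^T *m h ->
  DDJ + (DJu *m Bv + J *m dBuv) =
    dCuv *m J + Cv *m DJu + (Gu *m v^T *m h + G *m v^T *m hu) ->
  DDJ + (DJv *m Bu + J *m dBvu) =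
    dCvu *m J + Cu *m DJv + (Gv *m u^T *m h + G *m u^T *m hv) ->
  Gu = Cu *m G + G *m Cu^T -> Gv = Cv *m G + G *m Cv^T ->
  v *m Cu = u *m Cv ->
  J *m (dBuv - dBvu + Bv *m Bu - Bu *m Bv) =
  (dCuv - dCvu + Cv *m Cu - Cu *m Cv) *m J
  + G *m v^T *m (hu + h *m Bu) - G *m u^T *m (hv + h *m Bv).
Proof.
move=> /(canRL (addrK _)) eu /(canRL (addrK _)) ev e3 e4 eGu eGv.
move=> /(congr1 trmx); rewrite !trmx_mul => CT.
move: (congr2 (fun a b => a - b) e3 e4); rewrite eu ev eGu eGv.
rewrite ?(mulmxDl, mulmxDr, mulNmx, mulmxN) ?mulmxA.
rewrite -[G *m Cu^T *m v^T]mulmxA CT mulmxA => E.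
apply/matrixP => i j; move/matrixP/(_ i j) : E; rewrite ?mx_entryE.
repeat match goal with
| |- context [fun_of_matrix ?A ?i ?j] => move: (fun_of_matrix A i j) => ?
end.
by lra.
Qed.
End codazzi_algebra.

Section linear_maps_on_rows.
Variables (R : realType) (d : nat) (W : lmodType R).

Lemma lin_row_sum (f : 'rV[R]_d -> W) :
  (forall a u v, f (a *: u + v) = a *: f u + f v) ->
  forall w, f w = \sum_j w 0 j *: f (delta_mx 0 j).
Proof.
move=> fl w; rewrite {1}(row_sum_delta w).
have f0 : f 0 = 0 by have := fl (-1) 0 0; rewrite scaler0 addr0 scaleN1r addNr.
by elim/big_rec2 : _ => // j a b _ <-; exact: fl.
Qed.

End linear_maps_on_rows.

Section immersion.
Variables (R : realType) (k d : nat).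
Variables (U : set 'rV[R]_d) (g : 'rV[R]_d -> 'M[R]_d).
Hypotheses (oU : open U) (sg : smooth U g).
Hypothesis gT : forall x, U x -> (g x)^T = g x.
Hypothesis gpos : forall x, U x -> forall u, u != 0 -> 0 < ip (g x) u u.
Variables (V : set 'rV[R]_k) (F : 'rV[R]_k -> 'rV[R]_d).
Hypotheses (oV : open V) (sF : smooth V F) (FVU : forall y, V y -> U (F y)).
Hypothesis JF : forall y, V y -> row_free ('J F y).
Implicit Types (y u v w : 'rV[R]_k).

Let dF y : V y -> differentiable F y.
Proof. exact: smooth_differentiable. Qed.

Lemma derive_jacobian y v : V y -> 'D_v F y = v *m 'J F y.
Proof. by move=> Vy; rewrite deriveEjacobian//; exact: dF. Qed.

Lemma jacobian_smooth : smooth V (fun y => 'J F y).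
Proof.
apply/(smooth_mxP oV) => i j.
apply: (@smooth_ext _ _ _ oV _ (fun y => ('D_(delta_mx 0 i) F y) 0 j)).
  by move=> y Vy; rewrite derive_jacobian// -rowE mxE.
by move: (smooth_derive (delta_mx 0 i) sF) => /(smooth_mxP oV); exact.
Qed.

Definition pull_metric y : 'M[R]_k := 'J F y *m g (F y) *m ('J F y)^T.

Lemma pull_ip y u v : ip (pull_metric y) u v = ip (g (F y)) (u *m 'J F y) (v *m 'J F y).
Proof. by rewrite /ip /pull_metric trmx_mul !mulmxA. Qed.

Lemma pull_metric_smooth : smooth V pull_metric.
Proof.
have sJ := jacobian_smooth.
have sgF : smooth V (fun y => g (F y)) by exact: smooth_comp sg.
exact (smooth_mulmx oV (smooth_mulmx oV sJ sgF) (smooth_trmx oV sJ)).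
Qed.

Lemma pull_metricT y : V y -> (pull_metric y)^T = pull_metric y.
Proof. by move=> Vy; rewrite /pull_metric !trmx_mul trmxK gT ?mulmxA//; exact: FVU. Qed.

Lemma pull_metric_pos y : V y -> forall u, u != 0 -> 0 < ip (pull_metric y) u u.
Proof.
move=> Vy u u0; rewrite pull_ip; apply: gpos; first exact: FVU.
by apply: contra u0; rewrite mulmx_free_eq0//; exact: JF.
Qed.

(** The connection form of the pullback of the tangent bundle along F. *)
Definition pull_conn y u : 'M[R]_d := conn g (F y) (u *m 'J F y).

Lemma pull_conn_sum y u : V y ->
  pull_conn y u = \sum_j (u *m 'J F y) 0 j *: conn g (F y) (delta_mx 0 j).
Proof.
move=> Vy.
exact: (lin_row_sum (conn_lin oU sg gT gpos (FVU Vy)) (u *m 'J F y)).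
Qed.

Let J_smooth := jacobian_smooth.

Let dJ y : V y -> differentiable (fun z => 'J F z) y.
Proof. exact: smooth_differentiable J_smooth. Qed.

Let connF_smooth e : smooth V (fun y => conn g (F y) e).
Proof. exact: (smooth_comp oV oU sF FVU (conn_smooth oU sg gpos e)). Qed.

Let vJ_coord_smooth v j : smooth V (fun y => (v *m 'J F y) 0 j).
Proof.
have : smooth V (fun y => v *m 'J F y).
  exact: (smooth_mulmx oV (smooth_cst V v) J_smooth).
by move=> /(smooth_mxP oV); exact.
Qed.

Lemma pull_conn_smooth u : smooth V (pull_conn ^~ u).
Proof.
apply: (@smooth_ext _ _ _ oV _
  (fun y => \sum_j (u *m 'J F y) 0 j *: conn g (F y) (delta_mx 0 j))).
  by move=> y Vy; rewrite pull_conn_sum.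
apply/(smooth_mxP oV) => a b r; under eq_fun do rewrite summxE.
apply: cdiff_sum => // j _; under eq_fun do rewrite mxE.
apply: cdiffM => //; first exact: vJ_coord_smooth.
by have /(smooth_mxP oV) := connF_smooth (delta_mx 0 j); exact.
Qed.

Lemma derive_pull_conn y u v : V y -> 'D_u (pull_conn ^~ v) y =
  conn g (F y) (v *m 'D_u (fun z => 'J F z) y)
  + dconn g (F y) (u *m 'J F y) (v *m 'J F y).
Proof.
move=> Vy; have Uy := FVU Vy; have dJy := dJ Vy; have dFy := dF Vy.
pose f j z := (v *m 'J F z) 0 j *: conn g (F z) (delta_mx 0 j).
have dvJ : differentiable (fun z => v *m 'J F z) y.
  exact: (@differentiable_mulmx _ _ _ _ _ (fun=> v)).
have df j : differentiable (f j) y.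
  rewrite /f; apply: differentiable_mx => a b; under eq_fun do rewrite mxE.
  apply: differentiableM; first exact: differentiable_mx_coord.
  exact/differentiable_mx_coord/(smooth_differentiable (connF_smooth _) Vy).
transitivity ('D_u (\sum_j f j) y).
  apply: (@derive_ext _ _ _ oV) Vy => z Vz.
  by rewrite fct_sumE; exact: pull_conn_sum.
rewrite derive_sum => [|j]; last exact: diff_derivable.
have L1 := lin_row_sum (conn_lin oU sg gT gpos Uy)
  (v *m 'D_u (fun z => 'J F z) y).
have L2 := lin_row_sum (fun a b c => dconn_linr oU sg gT gpos Uy a b c (u *m 'J F y))
  (v *m 'J F y).
rewrite {}L1 {}L2 -big_split; apply: eq_bigr => j _.
have dcj : differentiable (fun x => conn g x (delta_mx 0 j)) (F y).
  exact: smooth_differentiable (conn_smooth oU sg gpos _) Uy.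
have dconnF : differentiable (fun z => conn g (F z) (delta_mx 0 j)) y.
  exact: smooth_differentiable (connF_smooth _) Vy.
have E1 : 'D_u (fun z => (v *m 'J F z) 0 j) y = (v *m 'D_u (fun z => 'J F z) y) 0 j.
  rewrite -(derive_mulmxr v u dJy).
  exact: (esym (derive_mx_coord u 0 j dvJ)).
have E2 : 'D_u (fun z => conn g (F z) (delta_mx 0 j)) y =
    dconn g (F y) (u *m 'J F y) (delta_mx 0 j).
  rewrite -(derive_jacobian u Vy).
  exact: (derive_comp u dFy dcj).
rewrite [LHS](derive_scalemx u (differentiable_mx_coord 0 j dvJ) dconnF).
by rewrite E1 E2.
Qed.

(** Mixed second derivatives of F commute. *)
Lemma jacobian_derive_sym y u v : V y ->
  v *m 'D_u (fun z => 'J F z) y = u *m 'D_v (fun z => 'J F z) y.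
Proof.
move=> Vy; have dJy := dJ Vy.
rewrite -(derive_mulmxr v u dJy) -(derive_mulmxr u v dJy).
transitivity ('D_u ('D_v F) y).
  by apply: (@derive_ext _ _ _ oV) Vy => z Vz; rewrite derive_jacobian.
rewrite (derive_comm u v oV sF Vy).
by apply: (@derive_ext _ _ _ oV) Vy => z Vz; rewrite derive_jacobian.
Qed.

(** The curvature of the pullback connection is the pullback of the curvature: the
    terms in which the differential of F is differentiated are symmetric. *)
Lemma pull_riem y u v : V y ->
  riem g (F y) (u *m 'J F y) (v *m 'J F y) =
  'D_u (pull_conn ^~ v) y - 'D_v (pull_conn ^~ u) y
  + pull_conn y v *m pull_conn y u - pull_conn y u *m pull_conn y v.
Proof.
move=> Vy; rewrite (derive_pull_conn u v Vy) (derive_pull_conn v u Vy).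
rewrite (jacobian_derive_sym u v Vy) /riem /curv_mx -/(pull_conn y u) -/(pull_conn y v).
have cancel (a b c p q : 'M[R]_d) : b - c + p - q = a + b - (a + c) + p - q.
  by mx_ring.
exact: cancel.
Qed.

Local Notation gN := pull_metric.
Let sgN := pull_metric_smooth.

Variable h : 'rV[R]_k -> 'rV[R]_d.
Hypothesis k_gt0 : (0 < k)%N.
Hypothesis umbilical : forall y, V y -> forall u v,
  'D_u (fun z => v *m 'J F z) y + christoffel g (F y) (u *m 'J F y) (v *m 'J F y)
  - nabla gN (cst u) (cst v) y *m 'J F y = ip (gN y) u v *: h y.

Lemma gauss y u v : V y -> ip (gN y) u v *: h y =
  v *m ('D_u (fun z => 'J F z) y + 'J F y *m pull_conn y u - conn gN y u *m 'J F y).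
Proof.
move=> Vy; have Uy := FVU Vy; have dJy := dJ Vy.
rewrite -(umbilical Vy u v) (derive_mulmxr v u dJy).
rewrite (christoffelE sg gpos _ _ Uy) /nabla derive_cst add0r.
rewrite (christoffelE sgN pull_metric_pos _ _ Vy).
by rewrite mulmxBr mulmxDr !mulmxA.
Qed.

(** The second fundamental form evaluated on (e, e) is a nonzero multiple of h. *)
Lemma umbilical_smooth : smooth V h.
Proof.
pose e : 'rV[R]_k := delta_mx 0 (Ordinal k_gt0).
have e0 : e != 0.
  by apply/eqP => /rowP/(_ (Ordinal k_gt0))/eqP; rewrite !mxE !eqxx oner_eq0.
pose q z : 'rV[R]_d := e *m ('D_e (fun z => 'J F z) z + 'J F z *m pull_conn z e
  + (-1) *: (conn gN z e *m 'J F z)).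
apply: (@smooth_ext _ _ _ oV _ (fun y => (ip (gN y) e e)^-1 *: q y)).
  move=> y Vy; rewrite /q scaleN1r -gauss// scalerA mulVf ?scale1r//.
  by rewrite gt_eqF// pull_metric_pos.
have sJ := J_smooth; have sc := smooth_cst V.
apply: smooth_scalemx => //.
  apply: smoothV => //; last by apply: smooth_ip.
  by move=> y Vy; rewrite gt_eqF// pull_metric_pos.
apply: smooth_mulmx => //.
apply: smoothD => //; first apply: smoothD => //.
- exact: smooth_derive.
- exact: (smooth_mulmx oV sJ (pull_conn_smooth e)).
apply: smooth_scalemx => //; apply: smooth_mulmx => //.
exact: (conn_smooth oV sgN pull_metric_pos).
Qed.

Lemma gauss_mx y u : V y -> 'D_u (fun z => 'J F z) y + 'J F y *m pull_conn y u =
  conn gN y u *m 'J F y + gN y *m u^T *m h y.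
Proof.
move=> Vy; apply/row_matrixP => i; rewrite !rowE.
rewrite -[X in _ *m X = _](subrK (conn gN y u *m 'J F y)) mulmxDr -gauss//.
rewrite addrC mulmxDr; congr (_ + _).
rewrite (mulmxA _ (gN y *m u^T)) (mulmxA _ (gN y)).
rewrite (mx11_scalar (delta_mx 0 i *m gN y *m u^T)) mul_scalar_mx -/(ip (gN y) _ u).
by rewrite ipC// pull_metricT.
Qed.

(** The vectors hu and hv are the covariant derivatives of the mean curvature in the
    directions u and v. *)
Lemma codazzi y u v : V y -> exists hu hv : 'rV[R]_d,
  'J F y *m riem g (F y) (u *m 'J F y) (v *m 'J F y) =
  riem gN y u v *m 'J F y + gN y *m v^T *m hu - gN y *m u^T *m hv.
Proof.
move=> Vy; have dJy := dJ Vy.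
have dc w := smooth_differentiable (conn_smooth oV sgN pull_metric_pos w) Vy.
have dp w := smooth_differentiable (pull_conn_smooth w) Vy.
have dg := smooth_differentiable sgN Vy.
have dh := smooth_differentiable umbilical_smooth Vy.
have dDJ w := smooth_differentiable (smooth_derive w J_smooth) Vy.
(* The derivative of the Gauss formula for b in the direction a. *)
have D a b : 'D_a ('D_b (fun z => 'J F z)) y + ('D_a (fun z => 'J F z) y *m pull_conn y b
      + 'J F y *m 'D_a (pull_conn ^~ b) y) =
    dconn gN y a b *m 'J F y + conn gN y b *m 'D_a (fun z => 'J F z) y
    + (dmetric gN y a *m b^T *m h y + gN y *m b^T *m 'D_a h y).
  have dgb : differentiable (fun z => gN z *m b^T) y.
    exact: (@differentiable_mulmx _ _ _ _ _ _ (fun=> b^T)).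
  have E : 'D_a (fun z => 1 *: 'D_b (fun z => 'J F z) z + 'J F z *m pull_conn z b) y =
           'D_a (fun z => 1 *: (conn gN z b *m 'J F z) + gN z *m b^T *m h z) y.
    apply: (@derive_ext _ _ _ oV) Vy => z Vz.
    by rewrite !scale1r; exact: gauss_mx.
  move: E.
  rewrite (derive_lin 1 a (dDJ b) (differentiable_mulmx dJy (dp b))) scale1r.
  rewrite (derive_mulmx a dJy (dp b)).
  rewrite (derive_lin 1 a (differentiable_mulmx (dc b) dJy) (differentiable_mulmx dgb dh)).
  rewrite scale1r (derive_mulmx a (dc b) dJy) (derive_mulmx a dgb dh).
  by rewrite (derive_mulmxl b^T a dg).
exists ('D_u h y + h y *m pull_conn y u), ('D_v h y + h y *m pull_conn y v).
rewrite (pull_riem u v Vy) /riem /curv_mx.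
have Dvu := D v u; rewrite -(derive_comm u v oV J_smooth Vy) in Dvu.
have cm := conn_metric oV sgN pull_metricT pull_metric_pos Vy.
exact: (codazzi_algebra (gauss_mx u Vy) (gauss_mx v Vy) (D u v) Dvu (cm u) (cm v)
  (connC oV sgN pull_metricT pull_metric_pos Vy v u)).
Qed.

(** The orthogonality of w to u and v removes the derivatives of the mean curvature
    from the Codazzi equation; what remains is tangent. *)
Lemma umbilical_curv y u v w Z : V y ->
  ip (g (F y)) (u *m 'J F y) (w *m 'J F y) = 0 ->
  ip (g (F y)) (v *m 'J F y) (w *m 'J F y) = 0 ->
  (forall a, ip (g (F y)) (a *m 'J F y) Z = 0) ->
  curv g (F y) (u *m 'J F y) (v *m 'J F y) (w *m 'J F y) Z = 0.
Proof.
move=> Vy; rewrite -!pull_ip => uw vw JZ.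
rewrite (curvE oU sg gT gpos _ _ _ _ (FVU Vy)).
have [hu [hv E]] := codazzi u v Vy.
have wz a b : ip (gN y) a w = 0 -> w *m (gN y *m a^T *m b) = 0.
  move=> aw; rewrite (mulmxA w) (mulmxA w (gN y)).
  rewrite (mx11_scalar (w *m gN y *m a^T)) -/(ip (gN y) w a) mul_scalar_mx.
  by rewrite ipC ?pull_metricT// aw scale0r.
rewrite -mulmxA E mulmxBr mulmxDr (wz _ v hu vw) (wz _ u hv uw) subr0 addr0.
by rewrite (mulmxA w); exact: JZ.
Qed.

End immersion.

(** * Schur's lemma *)

Section curvature_of_metric.
Variables (R : realType) (d : nat) (U : set 'rV[R]_d) (g : 'rV[R]_d -> 'M[R]_d).
Hypotheses (oU : open U) (sg : smooth U g).
Hypothesis gT : forall x, U x -> (g x)^T = g x.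
Hypothesis gpos : forall x, U x -> forall u, u != 0 -> 0 < ip (g x) u u.
Implicit Types (x u v w z : 'rV[R]_d).

Lemma curv_curvature_like x : U x -> curvature_like (curv g x).
Proof.
move=> Ux.
have lA := conn_lin oU sg gT gpos Ux.
have ld := dconn_linl oU sg gpos Ux; have lr := dconn_linr oU sg gT gpos Ux.
have cE a b c e := curvE oU sg gT gpos a b c e Ux.
split.
- move=> a u v w z t; rewrite !cE /riem (curv_mx_linl a u v w lA ld lr).
  by rewrite mulmxDr -scalemxAr ipDl ipZl.
- move=> u v w z; rewrite !cE /riem (curv_mx_anti (conn g x) _ u v).
  by rewrite mulmxN ipNl.
- move=> u v w z; rewrite !cE /ip -(mulmxA w) (riem_skew oU sg gT gpos u v Ux).
  rewrite mulmxN mulNmx mxE; congr (- _).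
  have -> : w *m (g x *m (riem g x u v)^T) *m z^T =
      (z *m riem g x u v *m g x *m w^T)^T.
    by rewrite !trmx_mul trmxK (gT Ux) !mulmxA.
  by rewrite mxE.
move=> u v w z; rewrite !cE -!ipDl.
have -> := bianchi1 u v w (connC oU sg gT gpos Ux) (dconnC oU sg gT gpos Ux).
exact: ip0l.
Qed.

Lemma riem_of_constant_curvature x a : U x ->
  (forall u v w z, curv g x u v w z = a * unit_curv (ip (g x)) u v w z) ->
  forall u v, riem g x u v = a *: wedge_mx (g x) u v.
Proof.
move=> Ux H u v; apply/row_matrixP => i; rewrite !rowE.
apply: (@ip_inj _ _ (g x)) => [|z]; first by apply: posdef_unit; exact: gpos.
rewrite -(curvE oU sg gT gpos u v _ z Ux) H /unit_curv.
rewrite -scalemxAr ipZl wedge_mxE ipDl ipNl !ipZl.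
rewrite (ipC v _ (gT Ux)) (ipC u (delta_mx 0 i) (gT Ux)).
by ring_atoms.
Qed.

(** Strict Cauchy-Schwarz inequality. *)
Lemma gram_gt0 x (i j : 'I_d) : U x -> i != j ->
  0 < ip (g x) (delta_mx 0 i) (delta_mx 0 i) * ip (g x) (delta_mx 0 j) (delta_mx 0 j)
      - ip (g x) (delta_mx 0 i) (delta_mx 0 j) ^+ 2.
Proof.
move=> Ux ij; rewrite expr2; set e := delta_mx 0 i; set e' := delta_mx 0 j.
have e'0 : e' != 0.
  by apply/eqP => /rowP/(_ j)/eqP; rewrite !mxE !eqxx oner_eq0.
have E0 := gpos Ux e'0.
(* A multiple of the component of e orthogonal to e'. *)
pose w := ip (g x) e' e' *: e - ip (g x) e e' *: e'.
have w0 : w != 0.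
  apply/eqP => /rowP/(_ i)/eqP; rewrite !mxE !eqxx (negPf ij) /= mulr0 subr0 mulr1.
  by rewrite gt_eqF.
have := gpos Ux w0.
have -> : ip (g x) w w = ip (g x) e' e' *
    (ip (g x) e e * ip (g x) e' e' - ip (g x) e e' * ip (g x) e e').
  rewrite /w !ipDl !ipDr !ipNl !ipNr !ipZl !ipZr (ipC e' e (gT Ux)).
  by ring_atoms.
by rewrite pmulr_rgt0.
Qed.

(** Such a function a is smooth, because it is the sectional curvature of a fixed
    coordinate plane, a quotient of smooth functions; Schur's lemma then applies. *)
Lemma schur_curvature (a : 'rV[R]_d -> R) : (2 < d)%N ->
  (forall x, U x -> forall u v w z,
     curv g x u v w z = a x * unit_curv (ip (g x)) u v w z) ->
  smooth U a /\ forall x w, U x -> 'D_w a x = 0.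
Proof.
move=> d3 Ha.
have d1 : (1 < d)%N by exact: ltn_trans d3.
pose i : 'I_d := Ordinal (ltnW d1); pose j : 'I_d := Ordinal d1.
pose e : 'rV[R]_d := delta_mx 0 i; pose e' : 'rV[R]_d := delta_mx 0 j.
have pos x (Ux : U x) : 0 < ip (g x) e e * ip (g x) e' e' - ip (g x) e e' * ip (g x) e e'.
  by rewrite -expr2; exact: gram_gt0.
have sc (v : 'rV[R]_d) := smooth_cst U v.
have sip u v : smooth U (fun x => ip (g x) u v) by apply: smooth_ip.
have sa : smooth U a.
  apply: (@smooth_ext _ _ _ oU _ (fun x => (ip (g x) e e * ip (g x) e' e'
      - ip (g x) e e' * ip (g x) e e')^-1 * ip (g x) (e' *m riem g x e e') e)).
    move=> x Ux; rewrite -(curvE oU sg gT gpos e e' e' e Ux) (Ha x Ux) /unit_curv.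
    have p0 : ip (g x) e e * ip (g x) e' e' - ip (g x) e e' * ip (g x) e e' != 0.
      by rewrite gt_eqF// pos.
    rewrite (ipC e' e (gT Ux)) mulrCA [X in a x * (_ * (X - _))]mulrC.
    by rewrite mulVf// mulr1.
  apply: smoothM => //.
    apply: smoothV => //; first by move=> x Ux; rewrite gt_eqF// pos.
    by apply: smoothB => //; apply: smoothM.
  apply: smooth_ip => //; apply: smooth_mulmx => //.
  exact: (riem_smooth oU sg gpos).
split=> // x w Ux.
apply: (schur oU sg gT gpos w d3 sa) => // y Uy.
by apply: riem_of_constant_curvature => //; exact: Ha.
Qed.

Lemma derive0_locally_cst (a : 'rV[R]_d -> R) x : smooth U a ->
  (forall y w, U y -> 'D_w a y = 0) -> U x -> \forall y \near x, a y = a x.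
Proof.
move=> sa Da Ux.
have [r xr] := nbhs_ex (open_nbhs_nbhs (conj oU Ux) : nbhs x U).
have : nbhs x (ball x r%:num) by exact: nbhsx_ballx.
apply: filterS => y yr.
have seg (t : R) : 0 <= t <= 1 -> U (x + t *: (y - x)).
  move=> /andP[t0 t1]; apply: xr; move: yr; rewrite -!ball_normE /=.
  rewrite opprD addrA subrr add0r normrN normrZ ger0_norm// distrC => yr.
  by apply: le_lt_trans yr; rewrite ler_piMl.
have [|t /andP[/ltW t0 /ltW t1]] := @line_mvt _ _ a x (y - x).
  by move=> t /seg; exact: smooth_differentiable.
rewrite (addrC x (y - x)) subrK Da; last by apply: seg; rewrite t0.
by move/eqP; rewrite subr_eq0 => /eqP.
Qed.

End curvature_of_metric.

(** * Almost Hermitian manifolds *)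

(* From here on, coord is the coordinate map of a chart. *)
Import Defs.

Section charts.
Variables (R : realType).

Lemma local_dom_open k d (N : manifold R k) (M : manifold R d) (f : N -> M)
    (b : chart R N k) (c : chart R M d) : continuous f -> open (local_dom f b c).
Proof.
move=> cf; rewrite openE => _ [q [bq cfq] <-].
pose D := dom b `&` f @^-1` dom c.
have oD : open D.
  by apply: openI; [exact: dom_open|apply: open_comp => [x _|]; [exact: cf|exact: dom_open]].
have bD : nbhs (coord b q) (para b @^-1` D).
  apply: (para_continuous bq); rewrite (coordK bq).
  exact: open_nbhs_nbhs.
have bI : nbhs (coord b q) (coord b @` dom b).
  by apply: open_nbhs_nbhs; split; [exact: img_open|exists q].
apply: filterS (filterI bD bI) => z [Dz [p bp pz]].
by move: Dz; rewrite -pz /= (coordK bp) => Dp; exists p.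
Qed.

Lemma local_rep_img k d (N : manifold R k) (M : manifold R d) (f : N -> M)
    (b : chart R N k) (c : chart R M d) y :
  local_dom f b c y -> (coord c @` dom c) (local_rep f b c y).
Proof. by move=> [q [bq cfq] <-]; exists (f q) => //; rewrite /local_rep /= coordK. Qed.

Variables (d : nat) (M : manifold R d) (H : almost_hermitian M) (c : chart R M d).
Hypothesis ac : atlas c.
Local Notation U := (coord c @` dom c).

Lemma metricT x : U x -> (metric H c x)^T = metric H c x.
Proof. by move=> [p cp <-]; exact: metric_sym. Qed.

Lemma metric_gt0 x : U x -> forall u, u != 0 -> 0 < ip (metric H c x) u u.
Proof. by move=> [p cp <-]; exact: metric_pos. Qed.

End charts.

Section pointwise.
Variables (R : realType) (m n : nat) (M : manifold R (2 * m)) (H : almost_hermitian M).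
Hypotheses (n_ge1 : (1 <= n)%N) (n_lt_m : (n < m)%N).
Variables (p : M) (c : chart R M (2 * m)).
Hypothesis cp : chart_at p c.
Local Notation x := (coord c p).
Local Notation G := (metric H c x).
Local Notation J := (acs H c x).
Implicit Types X Y Z U : 'rV[R]_(2 * m).

Let ac : atlas c. Proof. by case: cp. Qed.
Let Ux : (coord c @` dom c) x. Proof. by exists p => //; case: cp. Qed.
Let GT := metricT H ac Ux.
Let Gpos := metric_gt0 H ac Ux.
Let JJ := acs_sqr H cp.
Let GJ := hermitian H cp.
Let oU := @img_open _ _ _ c.
Let sg := metric_smooth H ac.

Lemma umbilical_codazzi U (A : 'M[R]_((2 * n).+1, 2 * m)) :
  axiom_coholomorphic_spheres H n -> coholomorphic_plane J A ->
  (forall v, (v <= A)%MS -> ip G v U = 0) ->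
  forall P Q S, (P <= A)%MS -> (Q <= A)%MS -> (S <= A)%MS ->
  ip G P S = 0 -> ip G Q S = 0 -> curv (metric H c) x P Q S U = 0.
Proof.
move=> Hsph cA AU P Q S PA QA SA PS QS.
have [N [f [[sf _ imf] umb [q fq tq]]]] := Hsph p c cp A cA.
have [b ab bq] := atlas_cover q.
have cbq : chart_at q b by split.
have /andP[JA AJ] := tq b cbq.
set F := local_rep f b c in JA AJ; set y := coord b q in JA AJ.
have cfq : dom c (f q) by rewrite fq; case: cp.
have Vy : local_dom f b c y by exists q.
have Fy : F y = x by rewrite /F /local_rep /= (coordK bq) fq.
have [Pc eP] := submxP (submx_trans PA AJ).
have [Qc eQ] := submxP (submx_trans QA AJ).
have [Sc eS] := submxP (submx_trans SA AJ).
rewrite eP eQ eS -Fy in PS QS *.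
have cf : continuous f by case: sf.
have sF : smooth (local_dom f b c) F by case: sf => _; apply.
apply: (umbilical_curv oU sg (metricT H ac) (metric_gt0 H ac) (local_dom_open cf) sF
  (@local_rep_img _ _ _ _ _ f b c) (imf b c ab ac) (ltn0Sn _) (umb b c ab ac) Vy PS QS).
move=> a; rewrite Fy; apply: AU; exact: submx_trans (submxMl a _) JA.
Qed.

Lemma metric_curvature_like : curvature_like (curv (metric H c) x).
Proof. exact: (curv_curvature_like oU sg (metricT H ac) (metric_gt0 H ac) Ux). Qed.

Let JK X : X *m J *m J = - X. Proof. exact: mulmx_JJ. Qed.

Let gJl X Y : ip G (X *m J) Y = - ip G X (Y *m J).
Proof. exact: ipJl. Qed.

(** The triple Y, J Y, X lies in a coholomorphic plane orthogonal to U, hence is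
    tangent to an umbilical submanifold with normal vector U. *)
Lemma sphere_codazzi : axiom_coholomorphic_spheres H n ->
  coholomorphic_codazzi (ip G) (fun X => X *m J) (curv (metric H c) x).
Proof.
move=> Hsph Y X U [YX YJX] [YU YJU] XU; have cT := metric_curvature_like.
have [->|X0] := eqVneq X 0; first by rewrite (curv03 cT) (curv01 cT).
have [->|Y0] := eqVneq Y 0; first by rewrite (curv01 cT) (curv02 cT).
have [->|U0] := eqVneq U 0; first by rewrite !(curv04 cT).
have [A [cA [YA JYA XA AU]]] :=
  exists_coholomorphic n_ge1 n_lt_m JJ Gpos GJ X0 Y0 U0 YX YJX YU YJU XU.
have cod := umbilical_codazzi Hsph cA AU.
have JYX : ip G (Y *m J) X = 0 by rewrite gJl YJX oppr0.
have XJY : ip G X (Y *m J) = 0 by rewrite ipC// JYX.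
have YJY : ip G Y (Y *m J) = 0.
  by have := gJl Y Y; rewrite (ipC _ _ GT); lra.
by split; exact: cod.
Qed.

Lemma antiholomorphic_pair X Y : X != 0 -> Y != 0 ->
  ip G X Y = 0 -> ip G X (Y *m J) = 0 -> antiholomorphic_plane G J (col_mx X Y).
Proof.
move=> X0 Y0 XY XJY.
have YX : ip G Y X = 0 by rewrite ipC.
have JXY : ip G (X *m J) Y = 0 by rewrite gJl XJY oppr0.
have JYX : ip G (Y *m J) X = 0 by rewrite ipC.
have JZZ Z : ip G (Z *m J) Z = 0 by have := gJl Z Z; rewrite (ipC Z _ GT); lra.
split.
  rewrite /plane /row_free -addsmxE rank_add_row ?rank_rV ?X0//.
  apply/negP => /sub_rVP[a Ya]; have := Gpos Y0.
  by rewrite {2}Ya ipZr YX mulr0 ltxx.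
move=> u v; rewrite -!addsmxE => /sub_addsmxP[[a b] /= ->] /sub_addsmxP[[a' b'] /= ->].
rewrite (mx11_scalar a) (mx11_scalar b) (mx11_scalar a') (mx11_scalar b').
rewrite !mul_scalar_mx mulmxDl -!scalemxAl !ipDl !ipDr !ipZl !ipZr.
by rewrite !JZZ JXY JYX !mulr0 !addr0.
Qed.

(** The hypothesis on the type concerns unit vectors Y; both sides are quadratic in
    Y. *)
Lemma lambda_constant_type alpha X Y : pointwise_constant_type H alpha ->
  ip G X Y = 0 -> ip G X (Y *m J) = 0 ->
  curv (metric H c) x X Y Y X - curv (metric H c) x X Y (Y *m J) (X *m J) =
  alpha p * (ip G X X * ip G Y Y).
Proof.
move=> Htype XY XJY; have cT := metric_curvature_like; set T := curv _ _ in cT *.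
have [->|X0] := eqVneq X 0.
  by rewrite !(curv01 cT) ip0l; ring.
have [->|Y0] := eqVneq Y 0.
  by rewrite !(curv02 cT) ip0l; ring.
have Y1 := Gpos Y0; pose s := Num.sqrt (ip G Y Y).
have s0 : s != 0 by rewrite gt_eqF// sqrtr_gt0.
have ss : s * s = ip G Y Y by rewrite -expr2 sqr_sqrtr// ltW.
pose Z := s^-1 *: Y.
have ZY : Y = s *: Z by rewrite /Z scalerA divff// scale1r.
have Z0 : Z != 0 by rewrite scaler_eq0 invr_eq0 negb_or s0.
have ZZ : ip G Z Z = 1.
  by rewrite /Z ipZl ipZr -ss; field.
have XZ : ip G X Z = 0 by rewrite ipZr XY mulr0.
have XJZ : ip G X (Z *m J) = 0 by rewrite -scalemxAl ipZr XJY mulr0.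
have aXZ := antiholomorphic_pair X0 Z0 XZ XJZ.
have [E _] := Htype p c cp X Z Z aXZ aXZ XZ XZ ZZ ZZ.
move: E; rewrite /lambda -/T => E.
clearbody Z.
rewrite -ss ZY -scalemxAl !(curvZ2 cT) !(curvZ3 cT).
move: (T X Z Z X) (T X Z (Z *m J) (X *m J)) (ip G X X) E => t1 t2 i E.
transitivity (s * s * (t1 - t2)); first by ring.
by rewrite -E; ring.
Qed.

Lemma curv_constant_at alpha : (6 <= 2 * m)%N ->
  pointwise_constant_type H alpha -> axiom_coholomorphic_spheres H n ->
  forall X Y Z W, curv (metric H c) x X Y Z W = alpha p * unit_curv (ip G) X Y Z W.
Proof.
move=> m6 Htype Hsph.
apply: (@constant_curvature_of_codazzi _ _ (ip G) (fun X => X *m J)) => //.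
- by move=> a X Y Z; rewrite ipDl ipZl.
- by move=> X Y; exact: ipC.
- by move=> X Y; rewrite mulmxDl.
- move=> X Y; have [|Z Z0 ZXY] := exists_orthogonal G (s := [:: X; X *m J; Y; Y *m J]).
    exact: leq_trans m6.
  by exists Z => //; split; apply: ZXY; rewrite !inE eqxx ?orbT.
- exact: metric_curvature_like.
- exact: sphere_codazzi.
by move=> X Y [XY XJY]; exact: lambda_constant_type.
Qed.

End pointwise.

Section main.
Variables (R : realType) (m n : nat) (M : manifold R (2 * m)) (H : almost_hermitian M).
Variable alpha : M -> R.
Hypotheses (n_ge1 : (1 <= n)%N) (n_lt_m : (n < m)%N) (m6 : (6 <= 2 * m)%N).
Hypotheses (Htype : pointwise_constant_type H alpha).
Hypothesis Hsph : axiom_coholomorphic_spheres H n.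

Lemma type_locally_constant (p : M) : \forall q \near p, alpha q = alpha p.
Proof.
have [c ac cp] := atlas_cover p.
pose a y := alpha (para c y).
have aE q : dom c q -> a (coord c q) = alpha q by move=> cq; rewrite /a coordK.
have oU := @img_open _ _ _ c.
have sg := metric_smooth H ac.
have [|sa Da] := schur_curvature oU sg (metricT H ac) (metric_gt0 H ac)
    (leq_trans (isT : 2 < 6)%N m6) (a := a).
  move=> _ [q cq <-] u v w z; rewrite (aE q cq).
  exact: (curv_constant_at n_ge1 n_lt_m (conj ac cq) m6 Htype Hsph).
have Up : (coord c @` dom c) (coord c p) by exists p.
have a_near := derive0_locally_cst oU sa (fun y w Uy => Da y w Uy) Up.
have c_near : nbhs p (dom c) by apply: open_nbhs_nbhs; split=> //; exact: dom_open.
have a_near' : \forall q \near p, a (coord c q) = a (coord c p).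
  exact: (coord_continuous cp a_near).
by apply: filterS (filterI c_near a_near') => q [cq]; rewrite !aE.
Qed.

Lemma type_constant : connected [set: M] -> exists a, forall p, alpha p = a.
Proof.
move=> Mconn; have [[p _]|noM] := pselect (exists p : M, True); last first.
  by exists 0 => p; case: noM; exists p.
exists (alpha p); pose A := [set q | alpha q = alpha p].
have oA : open A.
  rewrite openE => q Aq; apply: filterS (type_locally_constant q) => r rq.
  by rewrite /A /= rq.
have oAC : open (~` A).
  rewrite openE => q Aq; apply: filterS (type_locally_constant q) => r rq.
  by rewrite /A /= rq.
have AT : A = [set: M].
  apply: Mconn; first by exists p.
    by exists A => //; rewrite setTI.
  by exists A; [rewrite -openC|rewrite setTI].
by move=> q; have : [set: M] q by []; rewrite -AT.
Qed.

End main.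

Theorem corollary3 (R : realType) (m n : nat) (M : manifold R (2 * m))
    (H : almost_hermitian M) (alpha : M -> R)
    (Mconn : connected [set: M])
    (n_ge1 : (1 <= n)%N) (n_lt_m : (n < m)%N) (dim_ge6 : (6 <= 2 * m)%N)
    (Htype : pointwise_constant_type H alpha)
    (Hsph : axiom_coholomorphic_spheres H n) :
  (exists a : R, (forall p, alpha p = a) /\ constant_curvature H a) /\
  global_constant_type H.
Proof.
have [a aE] := type_constant n_ge1 n_lt_m dim_ge6 Htype Hsph Mconn.
split.
  exists a; split=> // p c cp x X Y XX YY XY.
  rewrite (curv_constant_at n_ge1 n_lt_m cp dim_ge6 Htype Hsph) aE /unit_curv.
  by rewrite -/x XX YY XY; ring.
exists a => X Y _ _ orth p c cp x XX YY.
have [JXY XY] := orth p c cp.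
have XJY : ip (metric H c x) (X c x) (Y c x *m acs H c x) = 0.
  have := ipJl (acs_sqr H cp) (hermitian H cp) (X c x) (Y c x).
  by rewrite JXY => /eqP; rewrite eq_sym oppr_eq0 => /eqP.
by rewrite /lambda (lambda_constant_type cp Htype XY XJY) XX YY aE !mulr1.
Qed.
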